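(* Let $X\colon\mathbb{R}^{2}\times\mathbb{R}^{r}\to\mathbb{R}^{2}$, $(x,\lambda)\mapsto X(x,\lambda)$, be a smooth family of planar vector fields for which $0$ is a regular value, let $E=\{X=0\}$ (an $r$-dimensional manifold), let $\pi\colon E\to\mathbb{R}^{r}$ be the restriction of $(x,\lambda)\mapsto\lambda$, let $T=\operatorname{tr}D_{x}X$ and $D=\det D_{x}X$ be regarded as functions on $E$, and let $\Sigma=\{D=0\}\subset E$, $\widehat H=\{T=0\}\subset E$. Let $q\in E$ be a Bogdanov--Takens point, i.e. $T(q)=D(q)=0$ and $\operatorname{rank}D_{x}X(q)=1$; let $q_0$ span $\ker D_xX(q)$, let $\ell_{q}=\langle(q_{0},0)\rangle=\ker(d\pi_q|_{T_qE})$, and let $a,b$ be the Bogdanov--Takens coefficients associated with $q_{0}$. Then: (i) $dD_{q}(q_{0},0)=-2a$ and $dT_{q}(q_{0},0)=b$. (ii) $a\neq0$ if and only if $\ell_{q}\not\subset T^{\mathrm{lin}}_{q}\Sigma:=\ker(dD_{q}|_{T_{q}E})$; in that case $dD_{q}|_{T_{q}E}\neq0$, so $\Sigma$ is a hypersurface of $E$ near $q$ with $T_{q}\Sigma=T^{\mathrm{lin}}_{q}\Sigma$, and $\pi$ is a Whitney fold at $q$. (iii) If $dT_{q}|_{T_{q}E}\neq0$ (so that $\widehat H$ is a hypersurface of $E$ near $q$ and $T_{q}\widehat H=\ker(dT_{q}|_{T_{q}E})$), then $$b=0\iff \ell_{q}\subset T_{q}\widehat H\iff \pi|_{\widehat H}\text{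 is not an immersion at }q .$$ (iv) Conversely, let $q$ be any point of $\widehat H$ with $dT_{q}|_{T_{q}E}\neq0$ and $D_{x}X(q)\neq0$. If $\pi|_{\widehat H}$ fails to be an immersion at $q$, then $q$ is a Bogdanov--Takens point with $b=0$.
   Context: Bogdanov--Takens coefficients: at a point $q=(x_*,\lambda_* )\in E$ with $J=D_xX(q)$ nilpotent of rank one, put $B(u,v)=D_x^2X(q)[u,v]$ and let $q_0$ span $\ker J$. Choose $(q_1,p_0,p_1)$ with $Jq_1=q_0$, $J^{\top}p_1=0$, $J^{\top}p_0=p_1$, $\langle q_0,p_0\rangle=\langle q_1,p_1\rangle=1$, $\langle q_0,p_1\rangle=\langle q_1,p_0\rangle=0$; then $a=\tfrac12\langle p_1,B(q_0,q_0)\rangle$ and $b=\langle p_0,B(q_0,q_0)\rangle+\langle p_1,B(q_0,q_1)\rangle$. These depend only on the field $X(\cdot,\lambda_* )$ and on $q_0$; replacing $q_0$ by $cq_0$ multiplies both by $c$. A smooth map between $r$-dimensional manifolds is a Whitney fold at $q$ if in suitable local coordinates it is $(s_1,\dots,s_r)\mapsto(s_1^2,s_2,\dots,s_r)$. $\Sigma$ and $\widehat H$ are understood as germs at $q$. *)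

(* Defs.v *)
From HB Require Import structures.
From mathcomp Require Export all_boot all_order all_algebra.
From mathcomp Require Export all_classical all_reals all_analysis.
Export Order.TTheory GRing.Theory Num.Theory.
Export numFieldNormedType.Exports.

Set Implicit Arguments.
Unset Strict Implicit.
Unset Printing Implicit Defensive.


Local Open Scope classical_set_scope.
Local Open Scope ring_scope.

(* For U open and V finite-dimensional this is the usual class C^k on U; the
   values of f outside U play no role. *)
Fixpoint Ck (R : realType) (V W : normedModType R) (k : nat) (U : set V)
    (f : V -> W) : Prop :=
  match k with
  | 0%N => forall x, U x -> {for x, continuous f}
  | k'.+1 => (forall x, U x -> differentiable f x) /\
             (forall v : V, Ck k' U ('D_v f))
  end.

Definition Cinfty (R : realType) (V W : normedModType R) (U : set V)
    (f : V -> W) : Prop :=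
  forall k, Ck k U f.

(* Smoothness of f restricted to an arbitrary subset A: locally, f extends to
   a smooth map on an open subset of the ambient space. *)
Definition smooth_on (R : realType) (V W : normedModType R) (A : set V)
    (f : V -> W) : Prop :=
  forall x, A x -> exists (U : set V) (F : V -> W),
    [/\ open U, U x, Cinfty U F & {in A `&` U, F =1 f}].

(* phi, restricted to M `&` U, is a local coordinate system of M around q with
   values in R^n; only the values of phi on M `&` U matter. *)
Definition is_chart (R : realType) (V : normedModType R) (n : nat)
    (M : set V) (q : V) (U : set V) (phi : V -> 'rV[R]_n) : Prop :=
  [/\ M q, open U, U q, smooth_on (M `&` U) phi & open (phi @` (M `&` U))] /\
  exists psi : 'rV[R]_n -> V,
    smooth_on (phi @` (M `&` U)) psi /\ {in M `&` U, cancel phi psi}.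

Definition is_manifold (R : realType) (V : normedModType R) (n : nat)
    (M : set V) : Prop :=
  forall q, M q -> exists U (phi : V -> 'rV[R]_n), is_chart M q U phi.

(* Near q, S is a codimension-one submanifold of the n-dimensional manifold M:
   it is the zero set of one coordinate of some chart of M. *)
Definition hypersurface_near (R : realType) (V : normedModType R) (n : nat)
    (M S : set V) (q : V) : Prop :=
  S q /\ exists U (phi : V -> 'rV[R]_n) (i : 'I_n),
    is_chart M q U phi /\
    S `&` U = [set x | [/\ M x, U x & phi x 0 i = 0]].

(* Velocities at q of smooth curves lying in S; for a smooth submanifold this
   is the tangent space at q, as a subspace of the ambient space. *)
Definition tangent (R : realType) (V : normedModType R) (S : set V) (q : V) :
    set V :=
  [set v | exists (g : R -> V) (e : R),
    [/\ 0 < e, Cinfty `](- e), e[%classic g,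
        forall t, - e < t < e -> S (g t), g 0 = q & 'D_1 g 0 = v]].

(* The kernel of the differential at q of f restricted to S.  Here and below,
   the differential of a restriction is the restriction to the tangent space
   of the ambient differential. *)
Definition kerd (R : realType) (V W : normedModType R) (S : set V)
    (f : V -> W) (q : V) : set V :=
  [set v | tangent S q v /\ 'd f q v = 0].

Definition immersion_at (R : realType) (V W : normedModType R) (S : set V)
    (f : V -> W) (q : V) : Prop :=
  set_inj (tangent S q) ('d f q).

Definition fold_map (R : realType) (n : nat) (s : 'rV[R]_n) : 'rV[R]_n :=
  \row_(j < n) (if j == 0%N :> nat then s 0 j ^+ 2 else s 0 j).

(* The charts are centred at q and f q; without this, any local diffeomorphism
   would qualify, fold_map being one away from s_0 = 0. *)
Definition whitney_fold (R : realType) (V W : normedModType R) (n : nat)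
    (M : set V) (N : set W) (f : V -> W) (q : V) : Prop :=
  exists U (phi : V -> 'rV[R]_n) U' (phi' : W -> 'rV[R]_n),
    [/\ is_chart M q U phi, is_chart N (f q) U' phi',
        phi q = 0, phi' (f q) = 0 &
        forall x, M x -> U x ->
          [/\ N (f x), U' (f x) & phi' (f x) = fold_map (phi x)]].

Definition dotp (R : realType) (n : nat) (u v : 'rV[R]_n) : R :=
  \sum_(i < n) u 0 i * v 0 i.

Definition regular_value (R : realType) (V W : normedModType R) (f : V -> W)
    (c : W) : Prop :=
  forall q, f q = c -> range ('d f q) = setT.

(* Vectors are rows and the library's Jacobian acts on them from the right:
   D_xX(q)[u] = u *m DxX X q.  Thus "J u" is written u *m J, and "J^T u" is
   written u *m J^T. *)
Definition DxX (R : realType) (r : nat)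
    (X : 'rV[R]_2 * 'rV[R]_r -> 'rV[R]_2) (q : 'rV[R]_2 * 'rV[R]_r) :
    'M[R]_2 :=
  'J (fun x : 'rV[R]_2 => X (x, q.2)) q.1.

Definition D2xX (R : realType) (r : nat)
    (X : 'rV[R]_2 * 'rV[R]_r -> 'rV[R]_2) (q : 'rV[R]_2 * 'rV[R]_r)
    (u v : 'rV[R]_2) : 'rV[R]_2 :=
  'D_u ('D_v (fun x : 'rV[R]_2 => X (x, q.2))) q.1.

Definition trX (R : realType) (r : nat)
    (X : 'rV[R]_2 * 'rV[R]_r -> 'rV[R]_2) (q : 'rV[R]_2 * 'rV[R]_r) : R :=
  \tr (DxX X q).

Definition detX (R : realType) (r : nat)
    (X : 'rV[R]_2 * 'rV[R]_r -> 'rV[R]_2) (q : 'rV[R]_2 * 'rV[R]_r) : R :=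
  \det (DxX X q).

Definition Eset (R : realType) (r : nat)
    (X : 'rV[R]_2 * 'rV[R]_r -> 'rV[R]_2) : set ('rV[R]_2 * 'rV[R]_r) :=
  [set q | X q = 0].

Definition Sigma (R : realType) (r : nat)
    (X : 'rV[R]_2 * 'rV[R]_r -> 'rV[R]_2) : set ('rV[R]_2 * 'rV[R]_r) :=
  [set q | Eset X q /\ detX X q = 0].

Definition Hhat (R : realType) (r : nat)
    (X : 'rV[R]_2 * 'rV[R]_r -> 'rV[R]_2) : set ('rV[R]_2 * 'rV[R]_r) :=
  [set q | Eset X q /\ trX X q = 0].

Definition projpi (R : realType) (r : nat) (q : 'rV[R]_2 * 'rV[R]_r) :
  'rV[R]_r := q.2.

Definition BT_point (R : realType) (r : nat)
    (X : 'rV[R]_2 * 'rV[R]_r -> 'rV[R]_2) (q : 'rV[R]_2 * 'rV[R]_r) : Prop :=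
  [/\ Eset X q, trX X q = 0, detX X q = 0 & \rank (DxX X q) = 1%N].

Definition BT_frame (R : realType) (J : 'M[R]_2) (q0 q1 p0 p1 : 'rV[R]_2) :
    Prop :=
  [/\ (q0 == kermx J)%MS, q1 *m J = q0, p1 *m J^T = 0 & p0 *m J^T = p1] /\
  [/\ dotp q0 p0 = 1, dotp q1 p1 = 1, dotp q0 p1 = 0 & dotp q1 p0 = 0].

Definition BT_a (R : realType) (r : nat)
    (X : 'rV[R]_2 * 'rV[R]_r -> 'rV[R]_2) (q : 'rV[R]_2 * 'rV[R]_r)
    (q0 p1 : 'rV[R]_2) : R :=
  2^-1 * dotp p1 (D2xX X q q0 q0).

Definition BT_b (R : realType) (r : nat)
    (X : 'rV[R]_2 * 'rV[R]_r -> 'rV[R]_2) (q : 'rV[R]_2 * 'rV[R]_r)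
    (q0 q1 p0 p1 : 'rV[R]_2) : R :=
  dotp p0 (D2xX X q q0 q0) + dotp p1 (D2xX X q q0 q1).

(* The line spanned by (q0, 0) in the total space. *)
Definition ell (R : realType) (r : nat) (q0 : 'rV[R]_2) :
    set ('rV[R]_2 * 'rV[R]_r) :=
  [set v | exists c : R, v = c *: (q0, 0)].

(* Main.v *)
From HB Require Import structures.
From mathcomp Require Import perm ring lra.
Require Import Defs.

(** Everything rests on one device: for a smooth F : R^2 x R^r -> R^r such that
    d(X, F)_q is injective, the inverse function theorem makes F a chart of
    E = {X = 0} at q and produces curves in E with prescribed velocity.  With
    linear F, respectively with one coordinate of F replaced by det or tr, this
    gives the manifold and hypersurface statements and all tangent spaces.
    In a Bogdanov-Takens frame D_xX(q) = p1^T q0, which turns the derivatives of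
    det and tr along (q0, 0) into -2a and b.

    For the Whitney fold, the chart of E is (D, lambda_j)_(j <> i0), where i0 is
    a parameter direction transverse to the image of d pi_q.  Writing psi for
    its inverse and F = lambda_i0 o psi, pairing dX (d_0 psi) = 0 with a row of
    the adjugate of D_xX shows d_0 F = y_0 k(y) with k smooth and k(0) <> 0.
    Hence F(y) - F(0, y') = y_0^2 G(y), where
    G(y) = int_0^1 u k(u y_0, y') du is smooth and G(0) = k(0) / 2, and the fold
    coordinates are y_0 sqrt |G| and +-(lambda_i0 - F(0, y')). *)

Set Implicit Arguments.
Unset Strict Implicit.
Unset Printing Implicit Defensive.

Local Open Scope classical_set_scope.
Local Open Scope ring_scope.

(** * Calculus of C^k maps *)

Section Differentiability.
Context {R : realType} {V W : normedModType R}.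

(** [Ck] asks for derivatives along constant directions, whereas the chain rule differentiates the
    outer map along a moving one. Composition is therefore handled through coordinates of
    finite-dimensional spaces, and the inverse map and the parameter integral are differentiated by
    explicit remainder estimates. A transverse parameter i0 exists because [p1] annihilates the
    image of D_xX(q) while dX_q is onto. Since the trace vanishes at q, adj D_xX(q) = - D_xX(q), and
    the chosen adjugate row is [- p1] there; its pairing with the i0-th parameter derivative of X,
    the denominator of k, is thus nonzero near q. The condition a <> 0 enters as dD_q(q0, 0) <> 0.
    It makes D a coordinate of E, and as D grows at unit rate along d_0 psi, the vector d_0 psi(0)
    is a nonzero multiple of (q0, 0), whence k(0) <> 0. The integral formula for G settles its
    smoothness across y_0 = 0, where a quotient by y_0^2 says nothing. The sign of G(0), which no
    square can absorb, is moved to the target chart. *)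

Lemma diff_eps (f : V -> W) x : differentiable f x -> forall e, 0 < e ->
  \forall h \near (0 : V), `|f (h + x) - f x - 'd f x h| <= e * `|h|.
Proof.
move=> /diff_locallyP [_ /eqaddoP fx] e e0; have := fx e e0.
apply: filter_app; near=> h; rewrite /= !fctE /=.
by rewrite opprD addrA.
Unshelve. all: by end_near. Qed.

(** Serves to recognize a candidate [L] as the differential from an explicit remainder bound, as is
    done for inverse maps and for integrals depending on a parameter. *)
Lemma diff_epsP (f : V -> W) x (L : {linear V -> W}) : continuous L ->
  (forall e, 0 < e ->
     \forall h \near (0 : V), `|f (h + x) - f x - L h| <= e * `|h|) ->
  differentiable f x /\ 'd f x = L :> (V -> W).
Proof.
move=> Lc fL.
have fE : f \o shift x = cst (f x) + L +o_ 0 id.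
  apply/eqaddoP => e e0; apply: filterS (fL _ e0) => h.
  by rewrite !fctE /= opprD addrA.
have dE : 'd f x = L :> (V -> W) by exact: diff_unique.
by split => //; apply/diff_locallyP; rewrite dE.
Qed.

Lemma near_differentiable (f g : V -> W) x : (\near x, f x = g x) ->
  differentiable f x -> differentiable g x.
Proof.
move=> fg df; apply: (proj1 (@diff_epsP g x ('d f x) (diff_continuous df) _)).
move=> e e0; have := diff_eps df e0; apply: filter_app.
have : \forall h \near (0 : V), f (h + x) = g (h + x).
  have : \forall h \near (0 : V), (f \o shift x) h = (g \o shift x) h.
    by have := fg; rewrite (near_shift 0) /= => {}fg; apply: filterS fg => h /=;
      rewrite /= subr0.
  by [].
by apply: filterS => h ->; rewrite (nbhs_singleton fg).
Qed.

End Differentiability.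

Section CkBasics.
Context {R : realType} {V : normedModType R}.

Lemma open_near_eq (W : Type) (U : set V) (f g : V -> W) x : open U -> U x ->
  (forall y, U y -> f y = g y) -> \near x, f x = g x.
Proof.
by move=> oU Ux fg; apply: filterS fg _; exact: open_nbhs_nbhs.
Qed.

(** Derivatives at a point of an open set depend only on values nearby. Formulas for a derivative
    that hold on [U] alone can therefore be fed back into inductions on the order. *)
Lemma Ck_eq (W : normedModType R) k (U : set V) (f g : V -> W) : open U ->
  (forall x, U x -> f x = g x) -> Ck k U f -> Ck k U g.
Proof.
move=> oU; elim: k f g => [|k IH] f g fg /=.
  move=> fc x Ux; have fgx := open_near_eq oU Ux fg.
  rewrite /prop_for /continuous_at -(nbhs_singleton fgx).
  by apply: cvg_trans (fc _ Ux); exact: near_eq_cvg.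
move=> [df Df]; split => [x Ux|v].
  by apply: near_differentiable (df _ Ux); exact: (open_near_eq oU Ux fg).
apply: IH (Df v) => x Ux; apply: near_eq_derive; exact: (open_near_eq oU Ux fg).
Qed.

Lemma Ck_cont (W : normedModType R) k (U : set V) (f : V -> W) x :
  Ck k U f -> U x -> {for x, continuous f}.
Proof.
case: k => [|k] /=; first by move=> + Ux; apply.
by move=> [df _] Ux; exact/differentiable_continuous/df.
Qed.

Lemma CkS (W : normedModType R) k (U : set V) (f : V -> W) :
  Ck k.+1 U f -> Ck k U f.
Proof.
elim: k f => [|k IH] f; first by move=> fC x; exact: (Ck_cont fC).
by move=> [df Df]; split => // v; exact/IH/Df.
Qed.

Lemma Ck_sub (W : normedModType R) k (U U' : set V) (f : V -> W) :
  U' `<=` U -> Ck k U f -> Ck k U' f.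
Proof.
move=> UU; elim: k f => [|k IH] f /=; first by move=> fc x /UU; exact: fc.
by move=> [df Df]; split => [x /UU|v]; [exact: df|exact/IH/Df].
Qed.

Lemma Ck_cst (W : normedModType R) k (U : set V) (w : W) : Ck k U (cst w : V -> W).
Proof.
elim: k w => [|k IH] w /=; first by move=> x _; exact: cst_continuous.
split=> [x _|v]; first exact: differentiable_cst.
by rewrite (_ : 'D_v _ = cst 0) //; apply/funext => x; rewrite derive_cst.
Qed.

Lemma CkD (W : normedModType R) k (U : set V) (f g : V -> W) : open U ->
  Ck k U f -> Ck k U g -> Ck k U (fun x => f x + g x).
Proof.
move=> oU; elim: k f g => [|k IH] f g /=.
  by move=> fc gc x Ux; apply: continuousD; [exact: fc|exact: gc].
move=> [df Df] [dg Dg]; split=> [x Ux|v].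
  by apply: differentiableD; [exact: df|exact: dg].
apply: (Ck_eq oU _ (IH _ _ (Df v) (Dg v))) => x Ux.
by rewrite -deriveD //; apply: diff_derivable; [exact: df|exact: dg].
Qed.

Lemma Ck_sum (W : normedModType R) k (U : set V) n (f : 'I_n -> V -> W) :
  open U -> (forall i, Ck k U (f i)) -> Ck k U (fun x => \sum_i f i x).
Proof.
move=> oU fC.
have : Ck k U (fun x => \sum_(i <- index_enum 'I_n) f i x).
  elim: (index_enum _) => [|i s IH].
    apply: (Ck_eq oU _ (@Ck_cst W k U 0)) => x _; by rewrite big_nil.
  apply: (Ck_eq oU _ (CkD oU (fC i) IH)) => x _; by rewrite big_cons.
by [].
Qed.

Lemma derive_linear_comp (W W' : normedModType R) (L : {linear W -> W'})
    (f : V -> W) x v : continuous L -> differentiable f x ->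
  'D_v (L \o f) x = L ('D_v f x).
Proof.
move=> Lc df; have dL := linear_differentiable (f x) Lc.
rewrite !deriveE //; last exact: differentiable_comp.
by rewrite diff_comp //= diff_lin.
Qed.

Lemma Ck_linear_comp (W W' : normedModType R) k (U : set V) (f : V -> W)
    (L : {linear W -> W'}) : open U -> continuous L -> Ck k U f ->
  Ck k U (L \o f).
Proof.
move=> oU Lc; elim: k f => [|k IH] f /=.
  move=> fc x Ux; apply: continuous_comp; [exact: fc|exact: Lc].
move=> [df Df]; split=> [x Ux|v].
  by apply: differentiable_comp; [exact: df|exact: linear_differentiable].
apply: (Ck_eq oU _ (IH _ (Df v))) => x Ux.
by rewrite derive_linear_comp //; exact: df.
Qed.

Lemma Ck_linear (W : normedModType R) k (U : set V) (L : {linear V -> W}) :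
  continuous L -> Ck k U L.
Proof.
move=> Lc; case: k => [|k] /=; first by move=> x _; exact: Lc.
split=> [x _|v]; first exact: linear_differentiable.
rewrite (_ : 'D_v _ = cst (L v)); first exact: Ck_cst.
by apply/funext => x; rewrite deriveE ?diff_lin //; exact: linear_differentiable.
Qed.

Lemma CkM k (U : set V) (f g : V -> R) : open U ->
  Ck k U f -> Ck k U g -> Ck k U (fun x => f x * g x).
Proof.
move=> oU; elim: k f g => [|k IH] f g.
  by move=> /= fc gc x Ux; apply: continuousM; [exact: fc|exact: gc].
move=> fC gC; have [[df Df] [dg Dg]] := (fC, gC); split=> [x Ux|v].
  by apply: differentiableM; [exact: df|exact: dg].
apply: (Ck_eq oU _ (CkD oU (IH _ _ (CkS fC) (Dg v)) (IH _ _ (CkS gC) (Df v)))).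
move=> x Ux.
by rewrite [in RHS]deriveM //; apply: diff_derivable; [exact: df|exact: dg].
Qed.

Lemma CkN (W : normedModType R) k (U : set V) (f : V -> W) : open U ->
  Ck k U f -> Ck k U (fun x => - f x).
Proof.
move=> oU; elim: k f => [|k IH] f /=.
  by move=> fc x Ux; apply: continuousN; exact: fc.
move=> [df Df]; split=> [x Ux|v]; first by apply: differentiableN; exact: df.
apply: (Ck_eq oU _ (IH _ (Df v))) => x Ux.
by rewrite -deriveN //; apply: diff_derivable; exact: df.
Qed.

(** The derivative is [- f^-1 * f^-1] times that of [f], so order k+1 involves the inverse only at
    order k. The induction for the square root closes in the same way. *)
Lemma CkV k (U : set V) (f : V -> R) : open U -> (forall x, U x -> f x != 0) ->
  Ck k U f -> Ck k U (fun x => (f x)^-1).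
Proof.
move=> oU f0; elim: k => [|k IH] fC.
  by move=> x Ux; apply: continuousV; [exact: f0|exact: fC].
have [df Df] := fC; split=> [x Ux|v].
  by apply: differentiableV; [exact: df|exact: f0].
have VC := IH (CkS fC).
apply: (Ck_eq oU _ (CkN oU (CkM oU (CkM oU VC VC) (Df v)))) => x Ux.
rewrite deriveV ?f0 //; last by apply: diff_derivable; exact: df.
by rewrite -mulNr -invfM -expr2.
Qed.

Lemma Ck_sqrt k (U : set V) (f : V -> R) : open U -> (forall x, U x -> 0 < f x) ->
  Ck k U f -> Ck k U (fun x => Num.sqrt (f x)).
Proof.
move=> oU f0; elim: k => [|k IH] fC.
  move=> x Ux; apply: (@continuous_comp _ _ _ f Num.sqrt); first exact: fC.
  exact: sqrt_continuous.
have [df Df] := fC.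
have d1 x : U x -> is_derive (f x) 1 (Num.sqrt : R -> R) (2 * Num.sqrt (f x))^-1.
  by move=> Ux; apply: is_derive1_sqrt; exact: f0.
have d2 x : U x -> differentiable (Num.sqrt : R -> R) (f x).
  by move=> Ux; apply/derivable1_diffP; have [] := d1 x Ux.
have d3 x : U x -> differentiable (fun x => Num.sqrt (f x)) x.
  by move=> Ux; exact: (differentiable_comp (df _ Ux) (d2 _ Ux)).
split=> [//|v].
have sC := IH (CkS fC).
have C2 : Ck k U (fun x => (2 * Num.sqrt (f x))^-1).
  apply: (CkV oU) => [x Ux|]; last exact: CkM (Ck_cst _ _ _) sC.
  by rewrite mulf_neq0 // gt_eqF // sqrtr_gt0 f0.
apply: (Ck_eq oU _ (CkM oU (Df v) C2)) => x Ux.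
rewrite (deriveE _ (d3 _ Ux)).
rewrite (diff_comp (df _ Ux) (d2 _ Ux)) /= deriv1E /=; last by have [] := d1 x Ux.
rewrite derive1E; have [_ ->] := d1 x Ux.
by rewrite -deriveE; [|exact: df].
Qed.

End CkBasics.

(* Stated through coordinate functionals, so that a composite with a middle
   space W can be differentiated coordinate by coordinate. *)
Definition findim (R : realType) (W : normedModType R) : Prop :=
  exists n (e : 'I_n -> W) (c : 'I_n -> {linear W -> R}),
    (forall i, continuous (c i)) /\ forall w, w = \sum_i c i w *: e i.

Section Findim.
Context {R : realType}.

Lemma coord_linear m n i j : linear (fun M : 'M[R]_(m, n) => M i j).
Proof. by move=> a u v; rewrite !mxE. Qed.
Definition coordl m n i j : {linear 'M[R]_(m, n) -> R} :=
  HB.pack (fun M : 'M[R]_(m, n) => M i j)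
    (GRing.isLinear.Build R 'M[R]_(m, n) R _ _ (@coord_linear m n i j)).

Lemma findim_R : findim R.
Proof.
exists 1%N, (fun=> 1), (fun=> idfun); split=> [_ x//|w].
by rewrite big_ord1 /= /GRing.scale /= mulr1.
Qed.

Lemma findim_rV n : findim 'rV[R]_n.
Proof.
exists n, (fun i => delta_mx 0 i), (fun i => coordl 0 i).
split=> [i|w]; first exact: coord_continuous.
by rewrite [LHS]row_sum_delta.
Qed.

Lemma fst_linear (V W : normedModType R) : linear (fst : (V * W)%type -> V).
Proof. by []. Qed.
Lemma snd_linear (V W : normedModType R) : linear (snd : (V * W)%type -> W).
Proof. by []. Qed.
Definition fstl (V W : normedModType R) : {linear (V * W)%type -> V} :=
  HB.pack (@fst V W) (GRing.isLinear.Build R (V * W)%type V _ _ (@fst_linear V W)).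
Definition sndl (V W : normedModType R) : {linear (V * W)%type -> W} :=
  HB.pack (@snd V W) (GRing.isLinear.Build R (V * W)%type W _ _ (@snd_linear V W)).

Lemma fstl_continuous (V W : normedModType R) : continuous (fstl V W).
Proof. by move=> x; exact: cvg_fst. Qed.
Lemma sndl_continuous (V W : normedModType R) : continuous (sndl V W).
Proof. by move=> x; exact: cvg_snd. Qed.

Lemma pair0_linear (V W : normedModType R):
  linear (fun v : V => (v, 0) : (V * W)%type).
Proof. by move=> a u v; congr pair; rewrite /= scaler0 addr0. Qed.
Lemma pair0r_linear (V W : normedModType R):
  linear (fun w : W => (0, w) : (V * W)%type).
Proof. by move=> a u v; congr pair; rewrite /= scaler0 addr0. Qed.
Definition inll (V W : normedModType R) : {linear V -> (V * W)%type} :=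
  HB.pack (fun v : V => (v, 0) : (V * W)%type)
    (GRing.isLinear.Build R V (V * W)%type _ _ (@pair0_linear V W)).
Definition inrl (V W : normedModType R) : {linear W -> (V * W)%type} :=
  HB.pack (fun w : W => (0, w) : (V * W)%type)
    (GRing.isLinear.Build R W (V * W)%type _ _ (@pair0r_linear V W)).

Lemma inll_continuous (V W : normedModType R) : continuous (inll V W).
Proof. by move=> x; apply: cvg_pair => //; exact: cvg_cst. Qed.
Lemma inrl_continuous (V W : normedModType R) : continuous (inrl V W).
Proof. by move=> x; apply: cvg_pair => //; exact: cvg_cst. Qed.

Lemma findim_prod (V W : normedModType R) :
  findim V -> findim W -> findim (V * W)%type.
Proof.
move=> [m [e [c [cc ce]]]] [n [e' [c' [cc' ce']]]].
exists (m + n)%N, (fun i => match fintype.split i with inl j => (e j, 0)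
                                       | inr j => (0, e' j) end).
exists (fun i => match fintype.split i with
  | inl j => [the {linear (V * W)%type -> R} of c j \o fstl V W]
  | inr j => [the {linear (V * W)%type -> R} of c' j \o sndl V W] end).
split=> [i|w].
  case: fintype.split => j x; apply: continuous_comp.
  - exact: fstl_continuous.
  - exact: cc.
  - exact: sndl_continuous.
  - exact: cc'.
rewrite big_split_ord /=.
rewrite (eq_bigr (fun i => inll V W (c i w.1 *: e i))); last first.
  by move=> i _; rewrite (unsplitK (inl _ i)) /=; congr pair; rewrite scaler0.
rewrite -linear_sum -ce.
rewrite (eq_bigr (fun i => inrl V W (c' i w.2 *: e' i))); last first.
  by move=> i _; rewrite (unsplitK (inr _ i)) /=; congr pair; rewrite scaler0.
rewrite -linear_sum -ce'.
by case: w => x y; congr pair; rewrite /= ?addr0 ?add0r.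
Qed.

Lemma lineL_linear (W : normedModType R) (w : W) : linear (fun a : R => a *: w).
Proof. by move=> a u v; rewrite scalerDl scalerA. Qed.
Definition lineL (W : normedModType R) (w : W) : {linear R -> W} :=
  HB.pack (fun a : R => a *: w)
    (GRing.isLinear.Build R R W _ _ (@lineL_linear W w)).
Lemma lineL_continuous (W : normedModType R) (w : W) : continuous (lineL w).
Proof. by move=> x; exact: scalel_continuous. Qed.

Lemma findim_linear_continuous (W W' : normedModType R) (L : {linear W -> W'}) :
  findim W -> continuous L.
Proof.
move=> [n [e [c [cc ce]]]].
have -> : L = (fun w => \sum_i c i w *: L (e i)) :> (W -> W').
  apply/funext => w; rewrite {1}(ce w) linear_sum; apply: eq_bigr => i _.
  by rewrite linearZ.
move=> x.
have cC i : Ck 0 setT (fun w => c i w *: L (e i)).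
  apply: (Ck_linear_comp openT (@lineL_continuous _ (L (e i)))) => y _.
  exact: cc.
have := Ck_sum openT cC; exact.
Qed.

Lemma findim_Ck (V W : normedModType R) k (U : set V) (f : V -> W) :
  findim W -> open U ->
  (forall c : {linear W -> R}, continuous c -> Ck k U (c \o f)) -> Ck k U f.
Proof.
move=> [n [e [c [cc ce]]]] oU fC.
have sC : Ck k U (fun x => \sum_i (lineL (e i) \o (c i \o f)) x).
  apply: (Ck_sum oU) => i; apply: (Ck_linear_comp oU).
    exact: lineL_continuous.
  exact: fC.
by apply: (Ck_eq oU _ sC) => x _; rewrite [RHS]ce.
Qed.

Lemma derive_comp_sum (V W W' : normedModType R) n (e : 'I_n -> W)
    (c : 'I_n -> {linear W -> R}) (f : W -> W') (g : V -> W) x v :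
  (forall w, w = \sum_i c i w *: e i) -> differentiable g x ->
  differentiable f (g x) ->
  'D_v (f \o g) x = \sum_i c i ('D_v g x) *: 'D_(e i) f (g x).
Proof.
move=> ce dg df; rewrite deriveE; last exact: differentiable_comp.
rewrite diff_comp //= -(deriveE _ dg) {1}(ce ('D_v g x)) linear_sum.
by apply: eq_bigr => i _; rewrite linearZ /= -deriveE.
Qed.

(** With a scalar outer map, the derivative of the composite is a finite sum of products of
    ['D_(e i) f \o g] with coordinates of ['D_v g]. The directions [e i] are constant, so the
    induction hypothesis applies to each factor. *)
Lemma Ck_comp (V W W' : normedModType R) k (U : set V) (U' : set W)
    (f : W -> W') (g : V -> W) : findim W -> findim W' ->
  open U -> open U' -> (forall x, U x -> U' (g x)) ->
  Ck k U g -> Ck k U' f -> Ck k U (f \o g).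
Proof.
move=> fW fW' oU oU' gU gC fC.
apply: (findim_Ck fW' oU) => c cc.
have {}fC : Ck k U' (c \o f) by exact: Ck_linear_comp.
rewrite compA; move: {f c cc} (c \o f : W -> R) fC => f fC.
have [n [e [c [cc ce]]]] := fW.
elim: k f fC gC => [|k IH] f fC gC.
  by move=> x Ux; apply: continuous_comp; [exact: gC|exact/fC/gU].
have [[df Df] [dg Dg]] := (fC, gC); split=> [x Ux|v].
  by apply: differentiable_comp; [exact: dg|exact/df/gU].
have sC : Ck k U (fun x => \sum_i c i ('D_v g x) * 'D_(e i) f (g x)).
  apply: (Ck_sum oU) => i; apply: (CkM oU).
    exact: (Ck_linear_comp oU (cc i) (Dg v)).
  apply: (IH ('D_(e i) f)); [exact: Df|exact: CkS].
apply: (Ck_eq oU _ sC) => x Ux.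
by rewrite (derive_comp_sum _ ce) //; [exact: dg|exact/df/gU].
Qed.

Lemma Ck_pair (V W W' : normedModType R) k (U : set V) (f : V -> W)
    (g : V -> W') : open U -> Ck k U f -> Ck k U g ->
  Ck k U (fun x => (f x, g x)).
Proof.
move=> oU fC gC.
have sC := CkD oU (Ck_linear_comp oU (@inll_continuous W W') fC)
  (Ck_linear_comp oU (@inrl_continuous W W') gC).
by apply: (Ck_eq oU _ sC) => x _ /=; congr pair; rewrite /= ?addr0 ?add0r.
Qed.

Lemma Ck_row (V : normedModType R) n k (U : set V) (f : V -> 'rV[R]_n) :
  open U -> (forall i, Ck k U (fun x => f x 0 i)) -> Ck k U f.
Proof.
move=> oU fC.
have sC : Ck k U (fun x => \sum_i lineL (delta_mx 0 i : 'rV[R]_n) (f x 0 i)).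
  apply: (Ck_sum oU) => i; apply: (Ck_linear_comp oU) (fC i).
  exact: lineL_continuous.
by apply: (Ck_eq oU _ sC) => x _; rewrite [RHS]row_sum_delta.
Qed.

Lemma Ck_coord (V : normedModType R) m n k (U : set V) (f : V -> 'M[R]_(m, n))
  i j : open U -> Ck k U f -> Ck k U (fun x => f x i j).
Proof.
move=> oU fC; apply: (Ck_linear_comp oU (L := coordl i j)) fC.
exact: coord_continuous.
Qed.

Lemma Ck_prod (V : normedModType R) n k (U : set V) (f : 'I_n -> V -> R) :
  open U -> (forall i, Ck k U (f i)) -> Ck k U (fun x => \prod_i f i x).
Proof.
move=> oU fC.
have : Ck k U (fun x => \prod_(i <- index_enum 'I_n) f i x).
  elim: (index_enum _) => [|i s IH].
    by apply: (Ck_eq oU _ (@Ck_cst R V R k U 1)) => x _; rewrite big_nil.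
  by apply: (Ck_eq oU _ (CkM oU (fC i) IH)) => x _; rewrite big_cons.
by [].
Qed.

Lemma Ck_sumT (V W : normedModType R) (I : finType) k (U : set V)
    (f : I -> V -> W) :
  open U -> (forall i, Ck k U (f i)) -> Ck k U (fun x => \sum_i f i x).
Proof.
move=> oU fC.
apply: (Ck_eq oU _ (Ck_sum oU (fun i : 'I_#|I| => fC (enum_val i)))) => x _.
by rewrite [RHS](reindex _ (onW_bij _ (@enum_val_bij I))).
Qed.

Lemma Ck_det (V : normedModType R) n k (U : set V) (A : V -> 'M[R]_n) : open U ->
  (forall i j, Ck k U (fun x => A x i j)) -> Ck k U (fun x => \det (A x)).
Proof.
move=> oU AC; rewrite /determinant.
apply: (Ck_sumT oU) => s; apply: (CkM oU); first exact: Ck_cst.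
by apply: (Ck_prod oU) => i; exact: AC.
Qed.

(** Cramer's formula: the entries are cofactors divided by a determinant that does not vanish on
    [U]. *)
Lemma Ck_invmx (V : normedModType R) n k (U : set V) (A : V -> 'M[R]_n) :
  open U -> (forall x, U x -> A x \in unitmx) ->
  (forall i j, Ck k U (fun x => A x i j)) ->
  forall i j, Ck k U (fun x => invmx (A x) i j).
Proof.
move=> oU Au AC i j.
have iC : Ck k U (fun x => (\det (A x))^-1 * cofactor (A x) j i).
  apply: (CkM oU).
    apply: (CkV oU) => [x Ux|]; last exact: Ck_det.
    by have := Au _ Ux; rewrite unitmxE unitfE.
  rewrite /cofactor; apply: (CkM oU); first exact: Ck_cst.
  apply: (Ck_det oU) => a b.
  by apply: (Ck_eq oU _ (AC (lift j a) (lift i b))) => x _; rewrite !mxE.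
apply: (Ck_eq oU _ iC) => x Ux.
by rewrite /invmx Au // !mxE.
Qed.

End Findim.

(** * Inverse function theorem *)

(** Makes row vectors available as a complete normed module, the setting of the fixed point theorem
    used below. *)
HB.instance Definition _ (R : realType) m n := Complete.on 'M[R]_(m, n).

Section InverseFunction.
Context {R : realType}.

Lemma rV_norm_le n (v : 'rV[R]_n) (M : R) : 0 <= M ->
  (forall j, `|v 0 j| <= M) -> `|v| <= M.
Proof.
move=> M0 vM; rewrite [`|v|]mx_normrE; apply: bigmax_le => // -[i j] _ /=.
by rewrite ord1; exact: vM.
Qed.

Lemma rV_coord_norm_le n (v : 'rV[R]_n) j : `|v 0 j| <= `|v|.
Proof.
rewrite [`|v|]mx_normrE.
exact: (@le_bigmax _ _ _ 0 (fun ij : 'I_1 * 'I_n => `|v ij.1 ij.2|) (0, j)).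
Qed.

Lemma is_derive_line (V W : normedModType R) (f : V -> W) (y v : V) (t : R) :
  differentiable f (y + t *: v) ->
  is_derive t 1 (fun t => f (y + t *: v)) ('D_v f (y + t *: v)).
Proof.
move=> df; have dl : is_diff t (fun t : R => y + t *: v) (fun s => s *: v).
  have := @is_diffD R R V (cst y) (fun t : R => t *: v) 0 (fun s => s *: v) t.
  by rewrite add0r; apply.
have dlt : differentiable (fun t : R => y + t *: v) t by case: dl.
have dc : differentiable (f \o (fun t : R => y + t *: v)) t.
  exact: differentiable_comp.
apply: DeriveDef; first exact: diff_derivable.
rewrite [LHS](deriveE _ dc) diff_comp //= diff_val scale1r deriveE //.
Qed.

Lemma MVT_line (V : normedModType R) (f : V -> R) (y v : V) :
  (forall t : R, 0 <= t <= 1 -> differentiable f (y + t *: v)) ->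
  exists2 t : R, 0 <= t <= 1 & f (y + v) - f y = 'D_v f (y + t *: v).
Proof.
move=> df.
have dl (t : R) : t \in `[0, 1]%R ->
    is_derive t 1 (fun t => f (y + t *: v)) ('D_v f (y + t *: v)).
  by rewrite in_itv /= => t01; apply/is_derive_line/df.
pose phi (t : R) : R := f (y + t *: v); pose dphi (t : R) : R := 'D_v f (y + t *: v).
have phic : {within `[0, 1], continuous phi}.
  by apply: derivable_within_continuous => t t01; have [] := dl t t01.
have dphi01 (t : R) : t \in `]0, 1[%R -> is_derive t 1 phi (dphi t).
  by move=> t01; apply: dl; exact: subset_itv_oo_cc t01.
have [t] := MVT_segment (@ler01 R) dphi01 phic.
rewrite in_itv /= => t01; rewrite /phi /dphi scale1r scale0r addr0 subr0 mulr1 => fE.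
by exists t.
Qed.

(** The partial derivatives vanish at [a] and are continuous, hence small nearby; the mean value
    theorem on each coordinate gives the bound in the maximum norm. All small radii are covered so
    that further smallness conditions can be imposed. *)
Lemma C1_lipschitz n m (U : set 'rV[R]_n) (h : 'rV[R]_n -> 'rV[R]_m) a e :
  open U -> U a -> Ck 1 U h -> (forall v, 'd h a v = 0) -> 0 < e ->
  \forall d \near 0^'+, ball a d `<=` U /\
    forall x y, ball a d x -> ball a d y -> `|h x - h y| <= e * `|x - y|.
Proof.
move=> oU Ua [dh Dh] ha e0.
(* The successor keeps the denominator positive when the dimension is 0. *)
have n0 : 0 < n.+1%:R :> R by rewrite ltr0n.
have Nsmall : \forall z \near a, U z /\
    forall i : 'I_n, `|'D_(delta_mx 0 i) h z| <= e / n.+1%:R.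
  near=> z; split; first by near: z; exact: open_nbhs_nbhs.
  near: z; apply: filter_forall => i.
  have : {for a, continuous ('D_(delta_mx 0 i) h)} by exact: Dh.
  rewrite /prop_for /continuous_at deriveE ?ha; last exact: dh.
  move=> /cvgr0_norm_le; apply; exact: divr_gt0.
have [d0 /= d00 dB] := (nbhs_ballP _ _).1 Nsmall.
near=> d; have dd0 : d <= d0 by near: d; exact: nbhs_right_le.
have {}dB z : ball a d z -> U z /\
    forall i : 'I_n, `|'D_(delta_mx 0 i) h z| <= e / n.+1%:R.
  by move=> az; apply: dB; exact: le_ball az.
split=> [z /dB[]//|x y ax ay].
apply: rV_norm_le => [|j]; first by rewrite mulr_ge0 // ltW.
have xy (t : R) : 0 <= t <= 1 -> ball a d (y + t *: (x - y)).
  move=> /andP[t0 t1]; move: ax ay; rewrite -!ball_normE /= => ax ay.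
  have -> : a - (y + t *: (x - y)) = t *: (a - x) + (1 - t) *: (a - y).
    by apply/rowP => k; rewrite !mxE; ring.
  apply: (le_lt_trans (ler_normD _ _)); rewrite !normrZ.
  rewrite (ger0_norm t0) (@ger0_norm _ (1 - t)) ?subr_ge0 //.
  (* The strict inequality of the convexity estimate is taken from the term in [a - x], which
     disappears at t = 0. *)
  have [->|tn0] := eqVneq t 0; first by rewrite mul0r add0r subr0 mul1r.
  have tp : 0 < t by rewrite lt_def tn0.
  have -> : d = t * d + (1 - t) * d by ring.
  by apply: ltr_leD; [rewrite ltr_pM2l|rewrite ler_wpM2l ?subr_ge0 // ltW].
have dhj z : U z -> differentiable (coordl 0 j \o h) z.
  move=> Uz; apply: differentiable_comp; first exact: dh.
  exact: differentiable_coord.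
have [t t01] := @MVT_line _ (coordl 0 j \o h) y (x - y)
  (fun t t01 => dhj _ (dB _ (xy _ t01)).1).
rewrite [y + _]addrC subrK => hE.
have -> : (h x - h y) 0 j = 'D_(x - y) (coordl 0 j \o h) (y + t *: (x - y)).
  by rewrite -hE !mxE.
have [Uz Dz] := dB _ (xy _ t01); set z := y + _ in Uz Dz *.
rewrite derive_linear_comp //; [|exact: coord_continuous|exact: dh].
rewrite deriveE; last exact: dh.
rewrite {1}(row_sum_delta (x - y)) linear_sum /= summxE.
apply: (le_trans (ler_norm_sum _ _ _)).
apply: (@le_trans _ _ (\sum_(i < n) `|x - y| * (e / n.+1%:R))).
  apply: ler_sum => i _; rewrite linearZ /= mxE normrM.
  apply: ler_pM => //; first exact: rV_coord_norm_le.
  apply: le_trans (Dz i); rewrite deriveE; last exact: dh.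
  exact: rV_coord_norm_le.
rewrite sumr_const card_ord -[_ *+ n]mulr_natr -mulrA mulrC.
apply: ler_wpM2r => //; rewrite -mulrA ler_piMr ?(ltW e0) //.
by rewrite mulrC ler_pdivrMr // mul1r ler_nat.
Unshelve. all: by end_near. Qed.

Lemma jacobianE n m (f : 'rV[R]_n -> 'rV[R]_m) x v :
  'd f x v = v *m 'J f x.
Proof. by rewrite /jacobian mul_rV_lin1. Qed.

Lemma mulmxr_lipschitz n m (A : 'M[R]_(n, m)) :
  exists2 C, 0 < C & forall v : 'rV[R]_n, `|v *m A| <= C * `|v|.
Proof.
have := @linear_lipschitz R 'rV[R]_n 'rV[R]_m (mulmxr A).
apply; apply: findim_linear_continuous; exact: findim_rV.
Qed.

Lemma Ck_jacobian n m k (U : set 'rV[R]_n) (f : 'rV[R]_n -> 'rV[R]_m) i j :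
  open U -> Ck k.+1 U f -> Ck k U (fun x => 'J f x i j).
Proof.
move=> oU [df Df]; have := Ck_coord 0 j oU (Df (delta_mx 0 i)).
apply: (Ck_eq oU) => x Ux.
by rewrite deriveE ?jacobianE -?rowE ?mxE //; exact: df.
Qed.

Lemma jacobian_near_unit n (U : set 'rV[R]_n) (f : 'rV[R]_n -> 'rV[R]_n) a :
  open U -> U a -> Ck 1 U f -> 'J f a \in unitmx ->
  \forall x \near a, 'J f x \in unitmx.
Proof.
move=> oU Ua fC Ju.
have uE (A : 'M[R]_n) : (A \in unitmx) = (\det A != 0).
  by rewrite unitmxE unitfE.
have Ja : \det ('J f a) != 0 by rewrite -uE.
have dC : \det ('J f x) @[x --> a] --> \det ('J f a).
  by have := Ck_det oU (fun i j => Ck_jacobian i j oU fC); exact.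
near=> x; rewrite uE; near: x; exact: (cvgr_neq0 _ dC Ja).
Unshelve. all: by end_near. Qed.

(** Simplified Newton iteration: solving [f x = y] amounts to finding a fixed point of
    [x - f x *m A + y *m A], which the hypothesis makes a contraction with ratio 1/2. *)
Lemma open_mapping_local n (f : 'rV[R]_n -> 'rV[R]_n) (A : 'M[R]_n)
    (B : set 'rV[R]_n) : A \in unitmx -> open B ->
  (forall x y, B x -> B y ->
     `|(x - f x *m A) - (y - f y *m A)| <= 2^-1 * `|x - y|) ->
  open (f @` B).
Proof.
move=> Au oB hl; have [C C0 AC] := mulmxr_lipschitz A.
rewrite openE => _ [x0 Bx0 <-]; rewrite /interior.
have : \forall d \near (0:R)^'+, closed_ball x0 d `<=` B.
  have /nbhs_ballP[d /= d0 dB] := open_nbhs_nbhs (conj oB Bx0).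
  apply: filterS (filterI (nbhs_right_gt 0) (nbhs_right_lt d0)) => d' [d'0 d'd].
  by apply: subset_trans dB; exact: closed_ball_subset.
move=> /(filterI (nbhs_right_gt 0)) /filter_ex[d [/= d0 dB]].
(* With this radius [(y - f x0) *m A] has norm at most d/2; the contraction contributes another d/2,
   so the closed ball of radius [d] is mapped into itself. *)
apply/nbhs_ballP; exists (d / (2 * C)); first by rewrite /= divr_gt0 // mulr_gt0.
move=> y; rewrite -ball_normE /= distrC ltr_pdivlMr ?mulr_gt0 // => yd.
pose K := closed_ball x0 d; pose T x := x - f x *m A + y *m A.
have KE : K = [set x | `|x0 - x| <= d] by rewrite /K closed_ballE.
have TK : {homo T : x / K x >-> K x}.
  move=> x Kx; have Bx : B x by exact: dB.
  move: Kx; rewrite KE /= => xd.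
  have -> : x0 - T x = (x0 - f x0 *m A - (x - f x *m A)) - (y - f x0) *m A.
    by rewrite /T mulmxBl; apply/rowP => k; rewrite !mxE; ring.
  apply: (le_trans (ler_normB _ _)).
  have := hl _ _ Bx0 Bx; have := AC (y - f x0); nra.
pose Tf : {fun K >-> K} := mkfun_fun TK.
have Tc : is_contraction Tf.
  exists (2^-1)%:nng; split => /=; first by rewrite invf_lt1 // ltr1n.
  move=> [x x'] /= [Kx Kx'].
  have -> : T x - T x' = x - f x *m A - (x' - f x' *m A).
    by rewrite /T opprD addrACA subrr addr0.
  by apply: hl; exact: dB.
have [||x Kx xT] := @banach_fixed_point R 'rV[R]_n K Tf Tc.
- exact: closed_ball_closed.
- by exists x0; rewrite KE /= subrr normr0 ltW.
exists x; first exact: dB.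
have {}xT : x = x - f x *m A + y *m A := xT.
apply: (can_inj (mulmxK Au)); apply/esym/eqP; rewrite -subr_eq0; apply/eqP.
by apply: (addrI x); rewrite addr0 [in RHS]xT addrA addrAC.
Qed.

(** The remainder of [f] at [g y] is small relative to the increment of [g]. The Lipschitz bound
    makes it small relative to the increment of the argument, and applying the inverse Jacobian
    leaves the remainder of [g]. *)
Lemma inverse_differentiable n (f g : 'rV[R]_n -> 'rV[R]_n) (Y : set 'rV[R]_n)
    (C : R) y : open Y -> Y y -> (forall z, Y z -> f (g z) = z) ->
  (forall z z', Y z -> Y z' -> `|g z - g z'| <= C * `|z - z'|) ->
  differentiable f (g y) -> 'J f (g y) \in unitmx ->
  differentiable g y /\
  forall v, 'd g y v = v *m invmx ('J f (g y)).
Proof.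
move=> oY Yy fg gl df Ju; set J := 'J f (g y) in Ju *.
suff [dg dgE] : differentiable g y /\ 'd g y = mulmxr (invmx J) :> (_ -> _).
  by split=> // v; rewrite dgE.
have [C' C'0 JC] := mulmxr_lipschitz (invmx J).
apply: diff_epsP.
  by apply: findim_linear_continuous; exact: findim_rV.
move=> e e0.
have C1 : 0 < `|C| + 1 by rewrite ltr_wpDl.
(* [C'] pays for the inverse Jacobian and [|C| + 1] for the Lipschitz bound; the latter is positive
   whatever the sign of [C]. *)
have e1 : 0 < e / (C' * (`|C| + 1)) by rewrite divr_gt0 // mulr_gt0.
have /nbhs_ballP[d /= d0 dE] := diff_eps df e1.
have Yk : \forall k \near (0 : 'rV[R]_n), Y (k + y).
  have : \forall z \near y, Y z by exact: open_nbhs_nbhs.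
  by rewrite (near_shift 0) /=; apply: filterS => k /=; rewrite subr0.
near=> k.
have Yky : Y (k + y) by near: k.
set s := g (k + y) - g y.
have sC : `|s| <= (`|C| + 1) * `|k|.
  have := gl _ _ Yky Yy; rewrite -/s addrK => /le_trans -> //.
  apply: ler_wpM2r => //; have := ler_norm C; lra.
have sd : ball 0 d s.
  rewrite -ball_normE /= sub0r normrN; apply: (le_lt_trans sC).
  rewrite mulrC -ltr_pdivlMr //; near: k.
  apply: (@nbhs0_lt _ 'rV[R]_n); exact: divr_gt0.
have := dE _ sd; rewrite /= -/J jacobianE -/J /s subrK !fg // -/s addrK => rE.
have -> : s - k *m invmx J = - ((k - s *m J) *m invmx J).
  by rewrite mulmxBl mulmxK // opprB.
rewrite normrN; apply: (le_trans (JC _)).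
apply: (le_trans (ler_wpM2l (ltW C'0) rE)).
have -> : C' * (e / (C' * (`|C| + 1)) * `|s|) = e * (`|s| / (`|C| + 1)).
  by field; rewrite !gt_eqF.
by rewrite ler_wpM2l ?(ltW e0) // ler_pdivrMr // mulrC.
Unshelve. all: by end_near. Qed.

(** The map [x - f x *m A], with [A] the inverse Jacobian at [a], has zero differential at [a] and
    so is 1/2-Lipschitz on a ball. This yields injectivity, a Lipschitz inverse and openness of the
    image. Smoothness is bootstrapped: the differential of [g] at [y] is the inverse Jacobian of [f]
    at [g y], so class C^k of [g] gives class C^(k+1). *)
Theorem inverse_function_rV n (f : 'rV[R]_n -> 'rV[R]_n) (U : set 'rV[R]_n) a :
  open U -> U a -> Cinfty U f -> 'J f a \in unitmx ->
  exists B (g : 'rV[R]_n -> 'rV[R]_n),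
    [/\ open B, B a, B `<=` U, open (f @` B) & Cinfty (f @` B) g] /\
    {in B, cancel f g}.
Proof.
move=> oU Ua fC Ju; set A := invmx ('J f a).
have Au : A \in unitmx by rewrite unitmx_inv.
have [C C0 AC] := mulmxr_lipschitz A.
pose h x := x - f x *m A.
have hC : Ck 1 U h.
  apply: (CkD oU); first by apply: (@Ck_linear R 'rV[R]_n 'rV[R]_n 1 U idfun) => z; exact: cvg_id.
  apply: (CkN oU); apply: (Ck_linear_comp oU (L := mulmxr A)); last exact: fC.
  by apply: findim_linear_continuous; exact: findim_rV.
have ha v : 'd h a v = 0.
  have dfa : differentiable f a by have [+ _] := fC 1%N; exact.
  have Ac : continuous (mulmxr A : 'rV[R]_n -> 'rV[R]_n).
    by apply: findim_linear_continuous; exact: findim_rV.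
  have dAf : differentiable (mulmxr A \o f) a.
    by apply: differentiable_comp => //; exact: linear_differentiable.
  have dh := @is_diffB R _ _ id (mulmxr A \o f) id _ a (is_diff_id a)
    (differentiableP dAf).
  have -> : 'd h a v = v - 'd (mulmxr A \o f) a v.
    by have [_ dhE] := dh; exact: (congr1 (@^~ v) dhE).
  have -> : 'd (mulmxr A \o f) a v = 'd f a v *m A.
    exact: (eq_trans (esym (deriveE v dAf)) (eq_trans (derive_linear_comp v Ac dfa)
      (congr1 (mulmxr A) (deriveE v dfa)))).
  have -> : 'd f a v *m A = v by rewrite jacobianE /A mulmxK.
  by rewrite subrr.
have [d [d0 [[dU hl] dJ]]] : exists d, 0 < d /\ (ball a d `<=` U /\
    forall x y, ball a d x -> ball a d y -> `|h x - h y| <= 2^-1 * `|x - y|) /\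
    (forall x, ball a d x -> 'J f x \in unitmx).
  have half0 : 0 < 2^-1 :> R by [].
  have := C1_lipschitz oU Ua hC ha half0.
  have /nbhs_ballP[d1 /= d10 dJ] := jacobian_near_unit oU Ua (fC 1%N) Ju.
  have dlt : \forall d \near (0 : R)^'+, d <= d1 by exact: nbhs_right_le.
  move=> /(filterI dlt) /(filterI (nbhs_right_gt 0)) /filter_ex.
  move=> [d [d0 [dd1 hl]]]; exists d; split; first exact: d0.
  split; first exact: hl.
  move=> x ax; apply: dJ; exact: le_ball dd1 _ ax.
pose B := ball a d.
have oB : open B by exact: ball_open.
(* [x - y] is the sum of [h x - h y], of norm at most half of its own, and of [(f x - f y) *m A]. *)
have fl x y : B x -> B y -> `|x - y| <= (2 * C) * `|f x - f y|.
  move=> Bx By; have := hl _ _ Bx By; have := AC (f x - f y).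
  have -> : h x - h y = (x - y) - (f x - f y) *m A.
    by rewrite /h mulmxBl; apply/rowP => k; rewrite !mxE; ring.
  have := ler_distD 0 (x - y) ((f x - f y) *m A).
  have := lerB_normD (x - y) ((f x - f y) *m A).
  have := ler_normB (x - y - (f x - f y) *m A) (- ((f x - f y) *m A)).
  rewrite opprK subrK normrN; nra.
have oY : open (f @` B) by apply: (@open_mapping_local _ _ A).
(* The value [a] off the image is only a default. *)
pose g y := xget a [set x | B x /\ f x = y].
have gf x : B x -> g (f x) = x.
  move=> Bx; rewrite /g; case: xgetP => [z _ [Bz fz]|/(_ x)/=]; last by tauto.
  apply/eqP; rewrite -subr_eq0 -normr_le0; have := fl _ _ Bz Bx.
  by rewrite fz subrr normr0 mulr0.
have Bg y : (f @` B) y -> B (g y) by move=> [x Bx <-]; rewrite gf.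
have fg y : (f @` B) y -> f (g y) = y by move=> [x Bx <-]; rewrite gf.
have gl y y' : (f @` B) y -> (f @` B) y' -> `|g y - g y'| <= (2 * C) * `|y - y'|.
  by move=> [x Bx <-] [x' Bx' <-]; rewrite !gf //; exact: fl.
have dg y : (f @` B) y -> differentiable g y /\
    forall v, 'd g y v = v *m invmx ('J f (g y)).
  move=> Yy; apply: (inverse_differentiable oY Yy fg gl).
    have [+ _] := fC 1%N; apply; exact/dU/Bg.
  exact/dJ/Bg.
exists B, g; split; last by move=> x /[!inE]; exact: gf.
split => //; first exact: ballxx.
elim=> [|k IH].
  by move=> y Yy; apply/differentiable_continuous; have [] := dg _ Yy.
split=> [y Yy|v]; first by have [] := dg _ Yy.
apply: (Ck_row oY) => j.
have sC : Ck k (f @` B)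
    (fun y => \sum_i v 0 i * ((fun x => invmx ('J f x) i j) \o g) y).
  apply: (Ck_sum oY) => i; apply: (CkM oY); first exact: Ck_cst.
  apply: (Ck_comp (U' := B) _ _ oY oB Bg IH).
  - exact: findim_rV.
  - exact: findim_R.
  - apply: (Ck_invmx oB dJ) => i' j'.
    exact: (Ck_sub dU (Ck_jacobian i' j' oU (fC k.+1))).
apply: (Ck_eq oY _ sC) => y Yy.
by have [dgy gE] := dg _ Yy; rewrite deriveE // gE mxE.
Qed.

Lemma Ck_comp_linear (V W W' : normedModType R) k (U : set W) (f : W -> W')
    (L : {linear V -> W}) : findim V -> findim W -> findim W' -> open U ->
  Ck k U f -> Ck k (L @^-1` U) (f \o L).
Proof.
move=> fV fW fW' oU fC; have Lc := findim_linear_continuous (L := L) fV.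
apply: (Ck_comp fW fW' _ oU _ _ fC) => //.
  by apply: open_comp oU => x _; exact: Lc.
exact: Ck_linear.
Qed.

End InverseFunction.

Section LocalDiffeo.
Context {R : realType}.

Definition linear_iso (V W : normedModType R) (i : {linear V -> W})
    (j : {linear W -> V}) : Prop := cancel i j /\ cancel j i.

Lemma Cinfty_differentiable (V W : normedModType R) (U : set V) (f : V -> W) x :
  Cinfty U f -> U x -> differentiable f x.
Proof. by move=> fC Ux; have [+ _] := fC 1%N; exact. Qed.

Lemma Cinfty_continuous (V W : normedModType R) (U : set V) (f : V -> W) x :
  Cinfty U f -> U x -> {for x, continuous f}.
Proof. by move=> fC Ux; exact/differentiable_continuous/Cinfty_differentiable. Qed.

Lemma open_preimage_in (V W : normedModType R) (U : set V) (U' : set W)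
    (f : V -> W) : open U -> open U' -> (forall x, U x -> {for x, continuous f}) ->
  open (U `&` f @^-1` U').
Proof.
move=> oU oU' fc; rewrite openE => x [Ux U'x]; rewrite /interior.
apply: filterI; first exact: open_nbhs_nbhs.
by apply: (fc x Ux); exact: open_nbhs_nbhs.
Qed.

(** Conjugation by a linear isomorphism carries the result from rows to products. Injectivity of the
    differential at [a] makes the square Jacobian of the conjugate invertible. *)
Theorem inverse_function (V : normedModType R) n (i : {linear V -> 'rV[R]_n})
    (j : {linear 'rV[R]_n -> V}) (f : V -> V) (U : set V) a :
  findim V -> linear_iso i j ->
  open U -> U a -> Cinfty U f -> (forall v, 'd f a v = 0 -> v = 0) ->
  exists B (g : V -> V),
    [/\ open B, B a, B `<=` U, open (f @` B) & Cinfty (f @` B) g] /\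
    {in B, cancel f g}.
Proof.
move=> fV [ij ji] oU Ua fC df0.
have fr : findim 'rV[R]_n by exact: findim_rV.
have ic : continuous i by exact: findim_linear_continuous.
have jc : continuous j by exact: findim_linear_continuous.
have dfa : differentiable f a by exact: Cinfty_differentiable fC Ua.
pose f' : 'rV[R]_n -> 'rV[R]_n := i \o (f \o j).
have oU' : open (j @^-1` U) by apply: open_comp oU => x _; exact: jc.
have f'C : Cinfty (j @^-1` U) f'.
  by move=> k; apply: Ck_linear_comp => //; exact: Ck_comp_linear.
have U'a : (j @^-1` U) (i a) by rewrite /= ij.
have d1 : differentiable j (i a) by exact: linear_differentiable.
have d2 : differentiable f (j (i a)) by rewrite ij.
have d3 : differentiable (f \o j) (i a) by exact: differentiable_comp.
have Ju : 'J f' (i a) \in unitmx.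
  rewrite -row_free_unit -kermx_eq0; apply/eqP/row_matrixP => k; rewrite row0.
  have /sub_kermxP := row_sub k (kermx ('J f' (i a))).
  rewrite -jacobianE => vE; set v := row k _ in vE *.
  have E1 : 'd (f \o j) (i a) v = 'd f (j (i a)) ('d j (i a) v).
    by rewrite diff_comp.
  have E2 : 'd j (i a) v = j v by rewrite diff_lin.
  have : i ('d f a (j v)) = 0.
    rewrite -[RHS]vE -(deriveE _ (Cinfty_differentiable f'C U'a)).
    by rewrite (derive_linear_comp v ic d3) (deriveE _ d3) E1 E2 ij.
  move=> /(congr1 j); rewrite ij linear0 => /df0 /(congr1 i).
  by rewrite ji linear0.
have [B' [g' [[oB' B'a B'U oY' g'C] f'g]]] :=
  inverse_function_rV oU' U'a f'C Ju.
have YE : f @` (i @^-1` B') = i @^-1` (f' @` B').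
  apply/seteqP; split=> [_ [x B'x <-]|y [z B'z f'z]] /=.
    by exists (i x) => //; rewrite /f' /= ij.
  exists (j z); first by rewrite /= ji.
  by have := congr1 j f'z; rewrite /f' /= !ij.
have oY : open (i @^-1` (f' @` B')) by apply: open_comp oY' => x _; exact: ic.
exists (i @^-1` B'), (j \o (g' \o i)); split.
  split=> //.
  - by apply: open_comp oB' => x _; exact: ic.
  - by move=> x /B'U /=; rewrite ij.
  - by rewrite YE.
  - rewrite YE => k; apply: Ck_linear_comp => //; exact: Ck_comp_linear.
move=> x /[!inE] /= B'x /=.
have /= := f'g (i x); rewrite /f' /= ij => -> //; exact/mem_set.
Qed.

Lemma linear_iso_id n : linear_iso (idfun : {linear 'rV[R]_n -> 'rV[R]_n}) idfun.
Proof. by []. Qed.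

Lemma row_mx_linear m n :
  linear (fun x : 'rV[R]_m * 'rV[R]_n => row_mx x.1 x.2).
Proof. by move=> a u v; rewrite scale_row_mx add_row_mx. Qed.
Definition row_mxl m n : {linear ('rV[R]_m * 'rV[R]_n)%type -> 'rV[R]_(m + n)} :=
  HB.pack (fun x : 'rV[R]_m * 'rV[R]_n => row_mx x.1 x.2)
    (GRing.isLinear.Build R ('rV[R]_m * 'rV[R]_n)%type 'rV[R]_(m + n) _ _
       (@row_mx_linear m n)).

Lemma split_mx_linear m n : linear
  (fun x : 'rV[R]_(m + n) => (lsubmx x, rsubmx x) : ('rV[R]_m * 'rV[R]_n)%type).
Proof. by move=> a u v; rewrite !linearP. Qed.
Definition split_mxl m n : {linear 'rV[R]_(m + n) -> ('rV[R]_m * 'rV[R]_n)%type} :=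
  HB.pack (fun x : 'rV[R]_(m + n) => (lsubmx x, rsubmx x) : ('rV[R]_m * 'rV[R]_n)%type)
    (GRing.isLinear.Build R 'rV[R]_(m + n) ('rV[R]_m * 'rV[R]_n)%type _ _
       (@split_mx_linear m n)).

Lemma linear_iso_row_mx m n : linear_iso (row_mxl m n) (split_mxl m n).
Proof.
split=> [[x y]|x] /=; first by rewrite row_mxKl row_mxKr.
by rewrite hsubmxK.
Qed.

Lemma findim_rV2 m n : findim ('rV[R]_m * 'rV[R]_n)%type.
Proof. by apply: findim_prod; exact: findim_rV. Qed.

End LocalDiffeo.

(** * Charts and curves adapted to a level set *)

Section LevelSet.
Context {R : realType} (m r : nat).
Let V := ('rV[R]_m * 'rV[R]_r)%type.
Implicit Types (X : V -> 'rV[R]_m) (F : V -> 'rV[R]_r).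

Lemma d_pair (V' W W' : normedModType R) (f : V' -> W) (g : V' -> W') x v :
  differentiable f x -> differentiable g x ->
  'd (fun y => (f y, g y)) x v = ('d f x v, 'd g x v).
Proof. by move=> df dg; rewrite diff_pair. Qed.

Lemma Cinfty_pair (V' W W' : normedModType R) (U : set V') (f : V' -> W)
    (g : V' -> W') : open U -> Cinfty U f -> Cinfty U g ->
  Cinfty U (fun y => (f y, g y)).
Proof. by move=> oU fC gC k; exact: Ck_pair. Qed.

Lemma Cinfty_sub (V' W : normedModType R) (U U' : set V') (f : V' -> W) :
  U' `<=` U -> Cinfty U f -> Cinfty U' f.
Proof. by move=> UU fC k; exact: Ck_sub (fC k). Qed.

Lemma Cinfty_smooth_on (V' W : normedModType R) (U A : set V') (f : V' -> W) :
  open U -> A `<=` U -> Cinfty U f -> smooth_on A f.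
Proof. by move=> oU AU fC x Ax; exists U, f; split=> //; exact: AU. Qed.

(** In the coordinates [(X, F)] the level set is the slice with first component 0, so restricting
    the ambient inverse to this slice inverts [F]. Beyond the chart itself, the inverse [psi] is
    exposed as a smooth map on an open set, ready to be differentiated. *)
Lemma level_chart X F (U : set V) (q : V) :
  open U -> U q -> X q = 0 -> Cinfty U X -> Cinfty U F ->
  (forall v, 'd X q v = 0 -> 'd F q v = 0 -> v = 0) ->
  exists B (psi : 'rV[R]_r -> V), [/\ B `<=` U,
    is_chart [set x | X x = 0] q B F,
    open (F @` ([set x | X x = 0] `&` B)),
    Cinfty (F @` ([set x | X x = 0] `&` B)) psi &
    {in [set x | X x = 0] `&` B, cancel F psi}].
Proof.
move=> oU Uq Xq XC FC inj.
pose Phi : V -> V := fun x => (X x, F x).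
have PC : Cinfty U Phi by exact: Cinfty_pair.
have dP v : 'd Phi q v = 0 -> v = 0.
  rewrite /Phi d_pair; [|exact: Cinfty_differentiable XC Uq|
    exact: Cinfty_differentiable FC Uq].
  by move=> [Xv Fv]; exact: inj.
have [B [g [[oB Bq BU oY gC] Pg]]] :=
  inverse_function (findim_rV2 m r) (linear_iso_row_mx m r) oU Uq PC dP.
have YE : F @` ([set x | X x = 0] `&` B) = inrl _ _ @^-1` (Phi @` B).
  apply/seteqP; split=> [_ [x [/= Xx Bx] <-]|y [x Bx [Xx Fx]]] /=.
    by exists x => //; rewrite /Phi Xx.
  by exists x.
have rc : continuous (inrl 'rV[R]_m 'rV[R]_r) by exact: inrl_continuous.
have oY' : open (F @` ([set x | X x = 0] `&` B)).
  by rewrite YE; apply: open_comp oY => x _; exact: rc.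
have psiC : Cinfty (F @` ([set x | X x = 0] `&` B)) (g \o inrl _ _).
  rewrite YE => k; apply: Ck_comp_linear => //; first exact: findim_rV.
  - exact: findim_rV2.
  - exact: findim_rV2.
have psiK : {in [set x | X x = 0] `&` B, cancel F (g \o inrl _ _)}.
  move=> x /[!inE] -[/= Xx Bx].
  by have := Pg x; rewrite /Phi Xx; apply; exact/mem_set.
exists B, (g \o inrl _ _); split => //.
split; last by exists (g \o inrl _ _); split => //; exact: Cinfty_smooth_on psiC.
split => //; apply: (@Cinfty_smooth_on _ _ U) => // x [_ /BU]; exact.
Qed.

(** The curve is a straight line in the coordinates [(X, F)]. Both maps are therefore affine along
    it, and any function among them whose differential kills [w] stays constant. *)
Lemma level_curve X F (U : set V) (q w : V) :
  open U -> U q -> Cinfty U X -> Cinfty U F ->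
  (forall v, 'd X q v = 0 -> 'd F q v = 0 -> v = 0) ->
  exists (g : R -> V) (e : R),
    [/\ 0 < e, Cinfty `](- e), e[%classic g, g 0 = q, 'D_1 g 0 = w &
        forall t, - e < t < e -> X (g t) = X q + t *: 'd X q w /\
                                 F (g t) = F q + t *: 'd F q w].
Proof.
move=> oU Uq XC FC inj.
have dX : differentiable X q by exact: Cinfty_differentiable XC Uq.
have dF : differentiable F q by exact: Cinfty_differentiable FC Uq.
pose Phi : V -> V := fun x => (X x, F x).
have PC : Cinfty U Phi by exact: Cinfty_pair.
have dP v : 'd Phi q v = 0 -> v = 0.
  by rewrite /Phi d_pair // => -[Xv Fv]; exact: inj.
have [B [g [[oB Bq BU oY gC] Pg]]] :=
  inverse_function (findim_rV2 m r) (linear_iso_row_mx m r) oU Uq PC dP.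
have PgK y : (Phi @` B) y -> Phi (g y) = y.
  by move=> [x Bx <-]; rewrite Pg //; exact/mem_set.
pose l (t : R) : V := Phi q + t *: 'd Phi q w.
have lC : Cinfty setT l.
  move=> k; apply: CkD; [exact: openT|exact: Ck_cst|].
  exact: (Ck_linear _ _ (@lineL_continuous _ _ ('d Phi q w))).
have Yl : \forall t \near (0 : R), (Phi @` B) (l t).
  have := Cinfty_continuous lC (I : setT (0 : R)); apply.
  rewrite /l scale0r addr0; apply: open_nbhs_nbhs; split=> //; by exists q.
have [e /= e0 eY] := (nbhs_ballP _ _).1 Yl.
have eYt t : `](- e), e[%classic t -> (Phi @` B) (l t).
  move=> /= te; apply: eY; rewrite -ball_normE /= sub0r normrN.
  by rewrite ltr_norml; move: te; rewrite in_itv.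
have oI : open (`](- e), e[%classic : set R) by exact: itv_open.
have I0 : (`](- e), e[%classic : set R) 0 by rewrite /= in_itv /= oppr_lt0 e0.
have glC : Cinfty (`](- e), e[%classic : set R) (g \o l).
  move=> k; apply: (Ck_comp (U' := Phi @` B)) => //; try exact: findim_rV2.
  exact: Ck_sub (lC k).
have l0 : l 0 = Phi q by rewrite /l scale0r addr0.
have gl0 : (g \o l) 0 = q by rewrite /= l0 Pg //; exact/mem_set.
exists (g \o l), e; split => //.
- have dg : differentiable (g \o l) 0 by exact: Cinfty_differentiable glC I0.
  have dPq : differentiable Phi ((g \o l) 0).
    by rewrite gl0; exact: Cinfty_differentiable PC Uq.
  have E1 : 'D_1 (Phi \o (g \o l)) 0 = 'D_1 l 0.
    apply: near_eq_derive; apply: filterS Yl => t Yt /=; exact: PgK.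
  have E2 : 'D_1 l 0 = 'd Phi q w.
    have di : differentiable (@id V) (Phi q + 0 *: 'd Phi q w) by exact: ex_diff.
    by have [_ /= ->] := is_derive_line di; rewrite derive_id.
  have dPg : differentiable (Phi \o (g \o l)) 0 by exact: differentiable_comp.
  have : 'D_1 (Phi \o (g \o l)) 0 = 'd Phi ((g \o l) 0) ('d (g \o l) 0 1).
    have E3 := @deriveE _ _ _ _ (0 : R) (1 : R) dPg.
    have E4 := congr1 (@^~ (1 : R)) (diff_comp dg dPq).
    exact: (eq_trans E3 E4).
  rewrite gl0 E1 E2 -(deriveE _ dg) => /eqP.
  rewrite eq_sym -subr_eq0 -linearB => /eqP /dP /eqP; rewrite subr_eq0 => /eqP.
  by [].
- move=> t te; have Yt : (Phi @` B) (l t) by apply: eYt; rewrite /= in_itv.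
  have E : Phi (g (l t)) = Phi q + t *: (('d X q w, 'd F q w) : V).
    by rewrite PgK // /l /Phi d_pair.
  by split; [exact: (congr1 fst E)|exact: (congr1 snd E)].
Qed.

End LevelSet.

(** * Parameter integrals *)

Section Integral01.
Context {R : realType}.
Implicit Types f g : R -> R.

Definition int01 f : R := \int[@lebesgue_measure R]_(u in `[0, 1]) f u.

(** Two-sided continuity at every point of the segment, endpoints included. It is stronger than
    continuity within the segment and follows pointwise from continuity on an open set. *)
Definition cont01 f := forall u : R, 0 <= u <= 1 -> {for u, continuous f}.

Lemma cont01_within f : cont01 f -> {within `[0, 1], continuous f}.
Proof.
move=> fc; apply: continuous_in_subspaceT => u /[!inE] /=.
by rewrite in_itv /=; exact: fc.
Qed.

Lemma cont01_integrable f : cont01 f ->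
  (@lebesgue_measure R).-integrable `[0, 1] (EFin \o f).
Proof.
move=> fc; apply: continuous_compact_integrable; first exact: segment_compact.
exact: cont01_within.
Qed.

Lemma eq_int01 f g : (forall u : R, 0 <= u <= 1 -> f u = g u) -> int01 f = int01 g.
Proof.
move=> fg; apply: eq_Rintegral => u /[!inE] /=; rewrite in_itv /=; exact: fg.
Qed.

Lemma int01D f g : cont01 f -> cont01 g ->
  int01 (fun u => f u + g u) = int01 f + int01 g.
Proof. by move=> fc gc; apply: RintegralD => //; exact: cont01_integrable. Qed.

Lemma int01B f g : cont01 f -> cont01 g ->
  int01 (fun u => f u - g u) = int01 f - int01 g.
Proof. by move=> fc gc; apply: RintegralB => //; exact: cont01_integrable. Qed.

Lemma int01Z (a : R) f : cont01 f -> int01 (fun u => a * f u) = a * int01 f.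
Proof. by move=> fc; apply: RintegralZl => //; exact: cont01_integrable. Qed.

Lemma int01_cst (a : R) : int01 (cst a) = a.
Proof.
rewrite /int01 Rintegral_cst //= lebesgue_measure_itv /= lte_fin ltr01.
by rewrite oppr0 addr0 mulr1.
Qed.

Lemma cont01_cst (a : R) : cont01 (cst a).
Proof. by move=> u _; exact: cst_continuous. Qed.

Lemma cont01M f g : cont01 f -> cont01 g -> cont01 (fun u => f u * g u).
Proof. by move=> fc gc u u01; apply: continuousM; [exact: fc|exact: gc]. Qed.

Lemma cont01D f g : cont01 f -> cont01 g -> cont01 (fun u => f u + g u).
Proof. by move=> fc gc u u01; apply: continuousD; [exact: fc|exact: gc]. Qed.

Lemma cont01B f g : cont01 f -> cont01 g -> cont01 (fun u => f u - g u).
Proof. by move=> fc gc u u01; apply: continuousB; [exact: fc|exact: gc]. Qed.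

Lemma cont01X m : cont01 (fun u => u ^+ m).
Proof. by move=> u _; exact: exprn_continuous. Qed.

Lemma norm_int01_le f (M : R) : cont01 f ->
  (forall u : R, 0 <= u <= 1 -> `|f u| <= M) -> `|int01 f| <= M.
Proof.
move=> fc fM.
apply: (le_trans (le_normr_Rintegral _ (cont01_integrable fc))) => //.
rewrite -[leRHS]int01_cst; apply: le_Rintegral => //.
- apply: (@cont01_integrable (fun u => `|f u|)) => u u01.
  by apply: (@continuous_comp _ _ _ f Num.norm); [exact: fc|exact: norm_continuous].
- by apply: (@cont01_integrable (cst M)); exact: cont01_cst.
Qed.

Lemma int01_FTC (G g : R -> R) : cont01 g ->
  (forall u : R, 0 <= u <= 1 -> is_derive u 1 G (g u)) -> int01 g = G 1 - G 0.
Proof.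
move=> gc dG.
have GC (u : R) : 0 <= u <= 1 -> {for u, continuous G}.
  move=> u01; apply/differentiable_continuous/derivable1_diffP.
  by have [] := dG u u01.
have := @continuous_FTC2 R g G 0 1 ltr01 (cont01_within gc).
move=> FTC; rewrite /int01 /Rintegral FTC //=.
- split.
  + move=> u /subset_itv_oo_cc; rewrite in_itv /= => u01; by have [] := dG u u01.
  + by apply: cvg_at_right_filter; apply: GC; rewrite lexx ler01.
  + by apply: cvg_at_left_filter; apply: GC; rewrite lexx ler01.
- move=> u /subset_itv_oo_cc; rewrite in_itv /= => u01.
  by rewrite derive1E; have [_ ->] := dG u u01.
Qed.

End Integral01.

Section ParameterIntegral.
Context {R : realType} {V : normedModType R} (P Q : {linear V -> V}).
Hypothesis fV : findim V.

Definition seg (u : R) (x : V) : V := P x + u *: Q x.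

Definition seg_stable (U : set V) :=
  forall x (u : R), U x -> 0 <= u <= 1 -> U (seg u x).

(* The weight u^m makes the family stable under differentiation, whence
   smoothness by induction. *)
Definition pint m (K : V -> R) (x : V) : R :=
  int01 (fun u => u ^+ m * K (seg u x)).

Variables (U : set V).
Hypotheses (oU : open U) (sU : seg_stable U).

Lemma seg_continuous (p : R * V) :
  {for p, continuous (fun p : R * V => seg p.1 p.2)}.
Proof.
have Pc : continuous P by exact: findim_linear_continuous.
have Qc : continuous Q by exact: findim_linear_continuous.
apply: continuousD.
  by apply: continuous_comp; [exact: cvg_snd|exact: Pc].
apply: cvgZ; first exact: cvg_fst.
by apply: continuous_comp; [exact: cvg_snd|exact: Qc].
Qed.

Lemma segD u x y : seg u (x + y) = seg u x + seg u y.
Proof. by rewrite /seg !linearD /= addrACA. Qed.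

Lemma segZ u a x : seg u (a *: x) = a *: seg u x.
Proof. by rewrite /seg !linearZ /= scalerDr !scalerA mulrC. Qed.

Lemma cont01_seg (g : V -> R) x : (forall z, U z -> {for z, continuous g}) ->
  U x -> cont01 (fun u => g (seg u x)).
Proof.
move=> gc Ux u u01; apply: (@continuous_comp _ _ _ (fun u => seg u x) g).
  by apply: continuousD; [exact: cst_continuous|exact: scalel_continuous].
by apply: gc; exact: sU.
Qed.

(** Joint continuity gives, for each u, a neighbourhood of [(u, x)] with the required bound;
    compactness of the segment makes the neighbourhood of [x] independent of u. *)
Lemma seg_uniform (g : V -> R) x (e : R) :
  (forall z, U z -> {for z, continuous g}) -> U x -> 0 < e ->
  \forall y \near x, forall u : R, 0 <= u <= 1 ->
    `|g (seg u y) - g (seg u x)| <= e.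
Proof.
move=> gc Ux e0.
have e20 : 0 < e / 2 by rewrite divr_gt0.
have /compact_near_coveringP cvr := @segment_compact R 0 1.
have gs (u : R) : 0 <= u <= 1 ->
    {for (u, x), continuous (fun p : R * V => g (seg p.1 p.2))}.
  move=> u01; apply: (@continuous_comp _ _ _ (fun p : R * V => seg p.1 p.2) g).
    exact: seg_continuous.
  by apply: gc; exact: sU.
have cov (u : R) : `[0, 1]%classic u -> \forall u' \near u & y \near nbhs x,
    `|g (seg u' y) - g (seg u' x)| <= e.
  rewrite /= in_itv /= => u01.
  have /cvgrPdist_le/(_ _ e20) Nux := gs u u01.
  have gux : {for u, continuous (fun u => g (seg u x))} by exact: cont01_seg.
  have Nu : \forall u' \near u, `|g (seg u x) - g (seg u' x)| <= e / 2.
    by move: gux => /cvgrPdist_le; apply.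
  have [[A B] /= [Au Bx] AB] := Nux.
  exists (A `&` [set u' | `|g (seg u x) - g (seg u' x)| <= e / 2], B).
    by split=> //; exact: filterI.
  move=> [u' y] /= [[Au' Nu'] By]; have := AB (u', y) (conj Au' By).
  move=> /= Nuy; rewrite (splitr e).
  have -> : g (seg u' y) - g (seg u' x) =
    (g (seg u x) - g (seg u' x)) - (g (seg u x) - g (seg u' y)) by ring.
  by apply: (le_trans (ler_normB _ _)); exact: lerD.
have near_x := cvr V (nbhs x) _ _ cov.
near=> y; have Dy : `[0, 1]%classic `<=`
    (fun u' : R => `|g (seg u' y) - g (seg u' x)| <= e).
  by near: y; exact: near_x.
by move=> u u01; apply: Dy; rewrite /= in_itv.
Unshelve. all: by end_near. Qed.

Lemma diff_segE (K : V -> R) x u v : Cinfty U K -> U x -> 0 <= u <= 1 ->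
  'd K (seg u x) (seg u v) =
  'D_(P v) K (seg u x) + u * 'D_(Q v) K (seg u x).
Proof.
move=> KC Ux u01.
have dK : differentiable K (seg u x) by exact/(Cinfty_differentiable KC)/sU.
by rewrite !(deriveE _ dK) {2}/seg linearD linearZ.
Qed.

Lemma Cinfty_derive (W : normedModType R) (K : V -> W) v :
  Cinfty U K -> Cinfty U ('D_v K).
Proof. by move=> KC k; have [_ +] := KC k.+1; exact. Qed.

Lemma cont01_int (K : V -> R) m x : Cinfty U K -> U x ->
  cont01 (fun u => u ^+ m * K (seg u x)).
Proof.
move=> KC Ux; apply: cont01M; first exact: cont01X.
apply: cont01_seg => // z; exact: Cinfty_continuous KC.
Qed.

Lemma pintD (K1 K2 : V -> R) m x : Cinfty U K1 -> Cinfty U K2 -> U x ->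
  pint m K1 x + pint m K2 x = pint m (fun y => K1 y + K2 y) x.
Proof.
move=> K1C K2C Ux; rewrite /pint -int01D; try exact: cont01_int.
by apply: eq_int01 => u _; rewrite mulrDr.
Qed.

Lemma pintZ a (K : V -> R) m x : Cinfty U K -> U x ->
  a * pint m K x = pint m (fun y => a * K y) x.
Proof.
move=> KC Ux; rewrite /pint -int01Z; last exact: cont01_int.
by apply: eq_int01 => u _; rewrite mulrCA.
Qed.

Lemma eq_pint (K1 K2 : V -> R) m x : U x -> (forall z, U z -> K1 z = K2 z) ->
  pint m K1 x = pint m K2 x.
Proof. by move=> Ux KE; apply: eq_int01 => u u01; rewrite KE //; exact: sU. Qed.

(** Differentiation under the integral sign: a direction v moves [seg u x] by [P v + u *: Q v], and
    the factor u raises the exponent of the weight by one. *)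
Definition pint_diff m (K : V -> R) x v :=
  pint m ('D_(P v) K) x + pint m.+1 ('D_(Q v) K) x.

Lemma pint_derive_linear (L : {linear V -> V}) m (K : V -> R) x : Cinfty U K ->
  U x -> linear (fun v => pint m ('D_(L v) K) x).
Proof.
move=> KC Ux a v w; rewrite /= /GRing.scale /= pintZ //; last exact: Cinfty_derive.
rewrite pintD //; [|move=> k; apply: CkM => //; first exact: Ck_cst|];
  try exact: Cinfty_derive.
  apply: eq_pint => // z Uz.
  by rewrite !(deriveE _ (Cinfty_differentiable KC Uz)) linearP linearP.
Qed.

Lemma pint_diff_linear m (K : V -> R) x : Cinfty U K -> U x ->
  linear (pint_diff m K x).
Proof.
move=> KC Ux a v w; have E1 := @pint_derive_linear P m K x KC Ux a v w.
have E2 := @pint_derive_linear Q m.+1 K x KC Ux a v w.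
have arith (b A B C D : R) : b * A + B + (b * C + D) = b * (A + C) + (B + D).
  by ring.
exact: (eq_trans (congr2 +%R E1 E2) (arith _ _ _ _ _)).
Qed.

(** For each u the mean value theorem rewrites the remainder as a variation of the derivative of [K]
    along [seg u h]. Expanding this vector on the basis leaves finitely many functions ['D_(e i) K],
    whose variation is small uniformly in u, so the bound survives integration. *)
Lemma pint_differentiable m (K : V -> R) x : Cinfty U K -> U x ->
  differentiable (pint m K) x /\ forall v, 'd (pint m K) x v = pint_diff m K x v.
Proof.
move=> KC Ux.
pose L : {linear V -> R} := HB.pack (pint_diff m K x)
  (GRing.isLinear.Build R V R _ _ (pint_diff_linear m KC Ux)).
suff [dp dpE] : differentiable (pint m K) x /\ 'd (pint m K) x = L :> (V -> R).
  by split=> // v; rewrite dpE.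
apply: diff_epsP; first exact: findim_linear_continuous.
move=> eps eps0; have [n [e [c [cc ce]]]] := fV.
(* [k i] bounds the i-th coordinate of [seg u h] relative to the norm of [h], for all u at once. *)
have /choice[k kP] : forall i, exists k : R, 0 < k /\
    forall h (u : R), 0 <= u <= 1 -> `|c i (seg u h)| <= k * `|h|.
  move=> i.
  have cPc : continuous (c i \o P).
    by apply: (@findim_linear_continuous R V R (c i \o P)).
  have cQc : continuous (c i \o Q).
    by apply: (@findim_linear_continuous R V R (c i \o Q)).
  have [kp kp0 kpP] := @linear_lipschitz R V R (c i \o P) cPc.
  have [kq kq0 kqP] := @linear_lipschitz R V R (c i \o Q) cQc.
  exists (kp + kq); split=> [|h u /andP[u0 u1]]; first exact: addr_gt0.
  rewrite /seg linearD linearZ mulrDl; apply: (le_trans (ler_normD _ _)).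
  apply: lerD; first exact: kpP.
  rewrite normrM (ger0_norm u0); apply: le_trans (kqP h).
  by rewrite ler_piMl.
pose C := \sum_i k i.
have C0 : 0 <= C by apply: sumr_ge0 => i _; apply/ltW; have [] := kP i.
have C1 : 0 < C + 1 by rewrite ltr_wpDl.
(* The added 1 keeps the denominator positive when the sum [C] is empty. *)
have e0 : 0 < eps / (C + 1) by exact: divr_gt0.
have Near : \forall y \near x, U y /\ forall i (u : R), 0 <= u <= 1 ->
    `|'D_(e i) K (seg u y) - 'D_(e i) K (seg u x)| <= eps / (C + 1).
  near=> y; split; first by near: y; exact: open_nbhs_nbhs.
  near: y; apply: filter_forall => i.
  have dKc z : U z -> {for z, continuous ('D_(e i) K)}.
    exact: Cinfty_continuous (Cinfty_derive _ KC).
  exact: (seg_uniform dKc Ux e0).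
have [d /= d0 dB] := (nbhs_ballP _ _).1 Near.
near=> h.
have hd : `|h| < d by near: h; exact: nbhs0_lt.
have Bt (t : R) : 0 <= t <= 1 -> ball x d (x + t *: h).
  move=> /andP[t0 t1]; rewrite -ball_normE /= opprD addrA subrr sub0r normrN.
  by rewrite normrZ (ger0_norm t0); apply: le_lt_trans hd; rewrite ler_piMl.
have Uxh : U (h + x).
  have /dB[] : ball x d (x + 1 *: h) by apply: Bt; rewrite ler01 lexx.
  by rewrite scale1r addrC.
have c1 := @cont01_int K m _ KC Uxh.
have c2 := @cont01_int K m _ KC Ux.
have c3 := @cont01_int _ m _ (Cinfty_derive (P h) KC) Ux.
have c4 := @cont01_int _ m.+1 _ (Cinfty_derive (Q h) KC) Ux.
rewrite /= /pint_diff {1}/pint {1}/pint -int01B //.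
rewrite /pint -int01D // -int01B; [|exact: cont01B|exact: cont01D].
apply: norm_int01_le; first by apply: cont01B; [exact: cont01B|exact: cont01D].
move=> u u01; have [u0 u1] := andP u01.
have Us (t : R) : 0 <= t <= 1 -> U (seg u x + t *: seg u h).
  by move=> t01; rewrite -segZ -segD; apply: sU => //; have [] := dB _ (Bt _ t01).
have [t t01] := MVT_line (fun t t01 => Cinfty_differentiable KC (Us t t01)).
have dKx : differentiable K (seg u x) by exact/(Cinfty_differentiable KC)/sU.
have dKt := Cinfty_differentiable KC (Us _ t01).
rewrite -segD [x + h]addrC => KE.
have dE : 'D_(seg u h) K (seg u x) =
    'D_(P h) K (seg u x) + u * 'D_(Q h) K (seg u x).
  exact: (eq_trans (deriveE _ dKx) (diff_segE h KC Ux u01)).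
have sE z : differentiable K z ->
    'D_(seg u h) K z = \sum_i c i (seg u h) * 'D_(e i) K z.
  move=> dz; rewrite (deriveE _ dz) {1}(ce (seg u h)) linear_sum.
  by apply: eq_bigr => i _; rewrite linearZ (deriveE _ dz).
have -> : u ^+ m * K (seg u (h + x)) - u ^+ m * K (seg u x) -
    (u ^+ m * 'D_(P h) K (seg u x) + u ^+ m.+1 * 'D_(Q h) K (seg u x)) =
    u ^+ m * ('D_(seg u h) K (seg u x + t *: seg u h) - 'D_(seg u h) K (seg u x)).
  by rewrite -KE dE exprSr; ring.
rewrite normrM ger0_norm ?exprn_ge0 //.
apply: (@le_trans _ _ (1 * `|'D_(seg u h) K (seg u x + t *: seg u h) -
                             'D_(seg u h) K (seg u x)|)).
  by apply: ler_wpM2r => //; exact: exprn_ile1.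
rewrite mul1r (sE _ dKx) (sE _ dKt) -sumrB.
apply: (le_trans (ler_norm_sum _ _ _)).
apply: (@le_trans _ _ (\sum_i k i * `|h| * (eps / (C + 1)))).
  apply: ler_sum => i _; rewrite -mulrBr normrM.
  apply: ler_pM => //; first by have [_] := kP i; exact.
  rewrite -segZ -segD.
  by have [_] := dB _ (Bt _ t01); exact.
rewrite -mulr_suml -mulr_suml -/C.
have -> : C * `|h| * (eps / (C + 1)) = eps * `|h| * (C / (C + 1)).
  by field; rewrite gt_eqF.
by rewrite ler_piMr ?mulr_ge0 ?(ltW eps0) // ler_pdivrMr // mul1r lerDl.
Unshelve. all: by end_near. Qed.

Theorem pint_Cinfty m (K : V -> R) : Cinfty U K -> Cinfty U (pint m K).
Proof.
move=> + k; elim: k m K => [|k IH] m K KC.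
  move=> x Ux; apply: differentiable_continuous.
  by have [] := pint_differentiable m KC Ux.
split=> [x Ux|v]; first by have [] := pint_differentiable m KC Ux.
have sC := CkD oU (IH m _ (Cinfty_derive (P v) KC))
  (IH m.+1 _ (Cinfty_derive (Q v) KC)).
apply: (Ck_eq oU _ sC) => x Ux.
by have [dp dpE] := pint_differentiable m KC Ux; rewrite (deriveE _ dp) dpE.
Qed.

Lemma seg_FTC (K : V -> R) x : Cinfty U K -> U x ->
  K (P x + Q x) - K (P x) = int01 (fun u => 'D_(Q x) K (seg u x)).
Proof.
move=> KC Ux.
have dc : cont01 (fun u => 'D_(Q x) K (seg u x)).
  apply: (@cont01_seg ('D_(Q x) K) x) => // z Uz.
  exact: Cinfty_continuous (Cinfty_derive _ KC) Uz.
have dK (u : R) : 0 <= u <= 1 ->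
    is_derive u 1 (fun u => K (seg u x)) ('D_(Q x) K (seg u x)).
  by move=> u01; apply: is_derive_line; exact/(Cinfty_differentiable KC)/sU.
by rewrite (int01_FTC dc dK) /seg scale1r scale0r addr0.
Qed.

End ParameterIntegral.

(** * Level sets *)

Section KernelCoordinates.
Context {F : fieldType}.

(** The dimension count replaces the rank of the kernel by [n] in the type of the basis, so that the
    kernel gets coordinates in a fixed row space. *)
Lemma row_free_kermx m n (A : 'M[F]_(m + n, m)) : row_full A ->
  exists B : 'M[F]_(n, m + n), row_free B /\ (B :=: kermx A)%MS.
Proof.
move=> Af; have rk : \rank (kermx A) = n.
  by rewrite mxrank_ker (eqP Af) addKn.
move: (row_base (kermx A)) (row_base_free (kermx A)) (eq_row_base (kermx A)).
by rewrite rk => B Bf BE; exists B.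
Qed.

End KernelCoordinates.

Section Submanifolds.
Context {R : realType} (m r : nat).
Let V := ('rV[R]_m * 'rV[R]_r)%type.
Implicit Types (X : V -> 'rV[R]_m) (h : V -> R) (q : V).

(** [K] parametrizes the kernel and [rho] inverts it there. Being injective on the kernel, [rho] is
    the linear map that completes [A] to a local coordinate system. *)
Lemma kernel_coordinates (A : {linear V -> 'rV[R]_m}) : range A = setT ->
  exists (rho : {linear V -> 'rV[R]_r}) (K : {linear 'rV[R]_r -> V}),
    (forall y, A (K y) = 0) /\ (forall v, A v = 0 -> v = K (rho v)).
Proof.
move=> sA; pose a := lin1_mx (A \o split_mxl m r).
have aE v : A v = row_mxl m r v *m a.
  by rewrite /a mul_rV_lin1 /=; case: v => x y; rewrite /= row_mxKl row_mxKr.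
have af : row_full a.
  rewrite -sub1mx; apply/row_subP => i.
  have : range A (row i 1%:M) by rewrite sA.
  by move=> [v _ <-]; rewrite aE submxMl.
have [B [Bf BE]] := row_free_kermx af.
exists (mulmxr (pinvmx B) \o row_mxl m r), (split_mxl m r \o mulmxr B).
split=> [y|v Av].
  rewrite aE; have [_ ->] := linear_iso_row_mx (R := R) m r.
  by apply/sub_kermxP; rewrite /= -BE submxMl.
have vB : (row_mxl m r v <= B)%MS by rewrite BE; apply/sub_kermxP; rewrite -aE.
have [iK _] := linear_iso_row_mx (R := R) m r.
by rewrite /= mulmxKpV //; exact: esym (iK v).
Qed.

Lemma diff_coord (W : normedModType R) n (f : W -> 'rV[R]_n) x v j :
  differentiable f x -> ('d f x v) 0 j = 'd (fun x => f x 0 j) x v.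
Proof.
move=> df; have dj : differentiable (coordl 0 j \o f) x.
  by apply: differentiable_comp => //; exact: differentiable_coord.
have cc : continuous (coordl 0 j : 'rV[R]_n -> R) by exact: coord_continuous.
exact: (eq_trans (esym (congr1 (coordl 0 j) (deriveE v df)))
  (eq_trans (esym (derive_linear_comp v cc df)) (deriveE v dj))).
Qed.

Lemma tangent_diff0 (W W' : normedModType R) (S : set W) (f : W -> W') x v :
  differentiable f x -> (forall y, S y -> f y = 0) -> tangent S x v ->
  'd f x v = 0.
Proof.
move=> df f0 [g [e [e0 gC gS gx gv]]].
have I0 : (`](- e), e[%classic : set R) 0 by rewrite /= in_itv /= oppr_lt0 e0.
have dg : differentiable g (0 : R) by exact: Cinfty_differentiable gC I0.
have dfg : differentiable f (g 0) by rewrite gx.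
have dc : differentiable (f \o g) (0 : R) by exact: differentiable_comp.
have E1 : 'D_1 (f \o g) (0 : R) = 'd f (g 0) ('d g 0 (1 : R)).
  exact: (eq_trans (@deriveE _ _ _ _ (0 : R) (1 : R) dc)
           (congr1 (@^~ (1 : R)) (diff_comp dg dfg))).
have E2 : 'D_1 (f \o g) (0 : R) = 'D_1 (cst 0 : R -> W') (0 : R).
  apply: near_eq_derive.
  have : \forall t \near (0 : R), `](- e), e[%classic t.
    by apply: open_nbhs_nbhs; split=> //; exact: itv_open.
  by apply: filterS => t /=; rewrite in_itv /= => te; rewrite f0 //; exact: gS.
by rewrite -gv (deriveE _ dg) -gx -E1 E2 derive_cst.
Qed.

Lemma tangent_level X q : Cinfty setT X -> X q = 0 -> range ('d X q) = setT ->
  tangent [set x | X x = 0] q = [set v | 'd X q v = 0].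
Proof.
move=> XC Xq sX; apply/seteqP; split=> v /=.
  apply: tangent_diff0 => //; exact: Cinfty_differentiable XC (I : setT q).
move=> Xv; have [rho [K [_ KE]]] := kernel_coordinates sX.
have rhoc : continuous rho by apply: findim_linear_continuous; exact: findim_rV2.
have inj w : 'd X q w = 0 -> 'd rho q w = 0 -> w = 0.
  by move=> /KE {2}->; rewrite (diff_lin _ rhoc) => ->; rewrite linear0.
have rhoC : Cinfty setT rho by move=> k; exact: Ck_linear.
have [g [e [e0 gC g0 gv gX]]] := level_curve v openT (I : setT q) XC rhoC inj.
exists g, e; split=> // t /gX[+ _].
by rewrite Xq Xv scaler0 addr0.
Qed.

Lemma manifold_level X : Cinfty setT X -> regular_value X 0 ->
  is_manifold r [set x | X x = 0].
Proof.
move=> XC Xr q Xq; have [rho [K [_ KE]]] := kernel_coordinates (Xr _ Xq).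
have rhoc : continuous rho by apply: findim_linear_continuous; exact: findim_rV2.
have inj w : 'd X q w = 0 -> 'd rho q w = 0 -> w = 0.
  by move=> /KE {2}->; rewrite (diff_lin _ rhoc) => ->; rewrite linear0.
have rhoC : Cinfty setT rho by move=> k; exact: Ck_linear.
have [B [psi [_ cB _ _ _]]] := level_chart openT (I : setT q) Xq XC rhoC inj.
by exists B, rho.
Qed.

Lemma hypersurface_level X h q v : Cinfty setT X -> Cinfty setT h ->
  X q = 0 -> h q = 0 -> range ('d X q) = setT ->
  'd X q v = 0 -> 'd h q v != 0 ->
  hypersurface_near r [set x | X x = 0] [set x | X x = 0 /\ h x = 0] q /\
  tangent [set x | X x = 0 /\ h x = 0] q = kerd [set x | X x = 0] h q.
Proof.
move=> XC hC Xq hq sX Xv hv; have [rho [K [XK KE]]] := kernel_coordinates sX.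
have dX := Cinfty_differentiable XC (I : setT q).
have dh := Cinfty_differentiable hC (I : setT q).
have rhoc : continuous rho by apply: findim_linear_continuous; exact: findim_rV2.
(* The differential of [h] is nonzero on the kernel of ['d X q], hence on some basis vector of its
   parametrization. [h] can replace that coordinate of [rho]: once the other coordinates vanish,
   only multiples of this vector remain, and ['d h q] detects them. *)
have [j0 hj0] : exists j, 'd h q (K (delta_mx 0 j)) != 0.
  apply: contrapT => /forallNP hK; move/negP: hv; apply.
  rewrite (KE _ Xv) (row_sum_delta (rho v)) !linear_sum big1 // => j _.
  rewrite !linearZ; have /negP := hK j; rewrite negbK => /eqP ->.
  exact: mulr0.
pose G (x : V) : 'rV[R]_r := \row_j (if j == j0 then h x else rho x 0 j).
have GC : Cinfty setT G.
  move=> k; apply: (Ck_row openT) => j.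
  have [->|jj0] := eqVneq j j0.
    by apply: (Ck_eq openT _ (hC k)) => x _; rewrite mxE eqxx.
  apply: (Ck_eq openT _ (Ck_coord 0 j openT (Ck_linear k setT rhoc))) => x _.
  by rewrite mxE (negbTE jj0).
have dG := Cinfty_differentiable GC (I : setT q).
have dGh w : ('d G q w) 0 j0 = 'd h q w.
  rewrite (diff_coord _ _ dG); congr ('d _ q w).
  by apply/funext => x; rewrite mxE eqxx.
have dGrho w j : j != j0 -> ('d G q w) 0 j = rho w 0 j.
  move=> jj0; rewrite (diff_coord _ _ dG).
  rewrite (_ : (fun x => _) = (fun x => rho x 0 j)); last first.
    by apply/funext => x; rewrite mxE (negbTE jj0).
  by rewrite -diff_coord ?diff_lin //; exact: linear_differentiable.
have inj w : 'd X q w = 0 -> 'd G q w = 0 -> w = 0.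
  move=> Xw Gw; have rw j : j != j0 -> rho w 0 j = 0.
    by move=> jj0; rewrite -dGrho // Gw mxE.
  have rwE : rho w = rho w 0 j0 *: delta_mx 0 j0.
    apply/rowP => j; rewrite !mxE eqxx /=; have [->|jj0] := eqVneq j j0.
      by rewrite mulr1.
    by rewrite rw // mulr0.
  have : 'd h q w = 0 by rewrite -dGh Gw mxE.
  rewrite (KE _ Xw) rwE !linearZ /= => /eqP; rewrite mulf_eq0 (negbTE hj0) orbF.
  by move=> /eqP ->; rewrite scale0r.
have [B [psi [_ cB _ _ _]]] := level_chart openT (I : setT q) Xq XC GC inj.
split.
  split=> //; exists B, G, j0; split=> //.
  apply/seteqP; split=> x /=; rewrite mxE eqxx; first by move=> [[]].
  by move=> [].
rewrite /kerd tangent_level //; apply/seteqP; split=> w /=.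
  move=> Sw; split; first by apply: tangent_diff0 Sw => // y [].
  by apply: tangent_diff0 Sw => // y [].
move=> [Xw hw].
have [g [e [e0 gC g0 gw gX]]] := level_curve w openT (I : setT q) XC GC inj.
exists g, e; split=> // t /gX[XE GE]; split; first by rewrite XE Xq Xw scaler0 addr0.
have := congr1 (fun u : 'rV[R]_r => u 0 j0) GE.
by rewrite !mxE eqxx dGh hw mulr0 hq addr0.
Qed.

Lemma full_chart n (f : 'rV[R]_n -> 'rV[R]_n) (U : set 'rV[R]_n) a :
  open U -> U a -> Cinfty U f -> (forall v, 'd f a v = 0 -> v = 0) ->
  exists2 B, B `<=` U & is_chart setT a B f.
Proof.
move=> oU Ua fC inj.
have [B [g [[oB Ba BU oY gC] fg]]] :=
  inverse_function (findim_rV n) (linear_iso_id n) oU Ua fC inj.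
exists B => //; rewrite /is_chart setTI; split.
  by split=> //; exact: Cinfty_smooth_on oU BU fC.
by exists g; split=> //; exact: Cinfty_smooth_on oY _ gC.
Qed.

End Submanifolds.

(** * Bogdanov--Takens frames *)

Section Frames.
Context {R : realType}.
Implicit Types (J M : 'M[R]_2) (u v : 'rV[R]_2).

Lemma dotp2 u v : dotp u v = u 0 0 * v 0 0 + u 0 1 * v 0 1.
Proof.
rewrite /dotp !big_ord_recl big_ord0 addr0.
by congr (_ * _ + _ * _); congr (_ 0 _); apply/val_inj.
Qed.

Lemma mulmx2 n u (M : 'M[R]_(2, n)) j : (u *m M) 0 j = u 0 0 * M 0 j + u 0 1 * M 1 j.
Proof.
rewrite mxE !big_ord_recl big_ord0 addr0.
by have -> : lift ord0 ord0 = 1 :> 'I_2 by apply/val_inj.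
Qed.

Lemma dotpC n (u v : 'rV[R]_n) : dotp u v = dotp v u.
Proof. by apply: eq_bigr => i _; rewrite mulrC. Qed.

Lemma det2 M : \det M = M 0 0 * M 1 1 - M 0 1 * M 1 0.
Proof.
rewrite (expand_det_row _ 0) !big_ord_recl big_ord0 addr0 /cofactor !det_mx11.
rewrite !mxE /= expr0 expr1 mul1r mulN1r mulrN.
by congr (_ * M _ _ - M _ _ * M _ _); apply/val_inj.
Qed.

Lemma tr2 M : \tr M = M 0 0 + M 1 1.
Proof.
rewrite /mxtrace !big_ord_recl big_ord0 addr0.
by have -> : lift ord0 ord0 = 1 :> 'I_2 by apply/val_inj.
Qed.

Lemma row2P u v : u 0 0 = v 0 0 -> u 0 1 = v 0 1 -> u = v.
Proof.
move=> E0 E1; apply/rowP; case=> -[|[|//]] i.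
  by rewrite (_ : Ordinal i = 0) //; apply/val_inj.
by rewrite (_ : Ordinal i = 1) //; apply/val_inj.
Qed.

Lemma dotp_mul_tr J u v : dotp u (v *m J^T) = dotp (u *m J) v.
Proof. by rewrite !dotp2 !mulmx2 !mxE; ring. Qed.

(** The pairings say that the matrix with rows [q0], [q1] times the one with columns [p0], [p1] is
    the identity. For square matrices the product in the other order is the identity too, which is
    the resolution claimed. *)
Lemma dual_basis_sum (q0 q1 p0 p1 : 'rV[R]_2) :
  dotp q0 p0 = 1 -> dotp q1 p1 = 1 -> dotp q0 p1 = 0 -> dotp q1 p0 = 0 ->
  forall i j, p0 0 i * q0 0 j + p1 0 i * q1 0 j = (i == j)%:R.
Proof.
move=> e00 e11 e01 e10.
have mulT (u v : 'rV[R]_2) : u *m v^T = (dotp u v)%:M.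
  apply/matrixP => i j; rewrite !ord1 !mxE eqxx; apply: eq_bigr => k _.
  by rewrite mxE.
have QP : col_mx q0 q1 *m row_mx p0^T p1^T = 1%:M.
  rewrite mul_col_row !mulT e00 e11 e01 e10.
  by rewrite -[RHS]/(1%:M : 'M[R]_(1 + 1)) scalar_mx_block raddf0.
move=> i j; have := congr1 (fun A : 'M[R]_2 => A i j) (mulmx1C QP).
rewrite mul_row_col !mxE !big_ord1 !mxE; exact.
Qed.

Section Frame.
Variables (J : 'M[R]_2) (q0 q1 p0 p1 : 'rV[R]_2).
Hypothesis fr : BT_frame J q0 q1 p0 p1.

Lemma frame_kernel u : u *m J = 0 -> exists c, u = c *: q0.
Proof.
have [[/andP[_ kq] _ _ _] _] := fr => uJ.
by apply/sub_rVP; apply: submx_trans kq; apply/sub_kermxP.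
Qed.

Lemma frame_q0 : q0 *m J = 0.
Proof. by have [[/andP[qk _] _ _ _] _] := fr; apply/sub_kermxP. Qed.

Lemma frame_q0_neq0 : q0 != 0.
Proof.
have [_ [e00 _ _ _]] := fr; apply: contra_eq_neq e00 => ->.
by rewrite dotp2 !mxE !mul0r addr0 eq_sym oner_neq0.
Qed.

(** The i-th standard row is [p0 0 i *: q0 + p1 0 i *: q1], and [J] sends [q0] to 0 and [q1] to
    [q0]. *)
Lemma frameE i j : J i j = p1 0 i * q0 0 j.
Proof.
have [[_ q1J _ _] [e00 e11 e01 e10]] := fr.
have ds := dual_basis_sum e00 e11 e01 e10.
have J0 := congr1 (fun v : 'rV_2 => v 0 j) frame_q0.
have J1 := congr1 (fun v : 'rV_2 => v 0 j) q1J.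
rewrite mulmx2 mxE in J0; rewrite mulmx2 in J1.
rewrite -J1; have := ds i 0; have := ds i 1.
have [->|->] : i = 0 \/ i = 1.
  by case: i => -[|[|//]] ?; [left|right]; apply/val_inj.
- rewrite eqxx (_ : (0 == 1 :> 'I_2) = false) // => E1 E0.
  by transitivity (1%:R * J 0 j + 0%:R * J 1 j); [rewrite mul1r mul0r addr0|
    rewrite -E0 -E1; transitivity (p0 0 0 * (q0 0 0 * J 0 j + q0 0 1 * J 1 j) +
     p1 0 0 * (q1 0 0 * J 0 j + q1 0 1 * J 1 j)); [ring|rewrite J0; ring]].
- rewrite eqxx (_ : (1 == 0 :> 'I_2) = false) // => E1 E0.
  by transitivity (0%:R * J 0 j + 1%:R * J 1 j); [rewrite mul1r mul0r add0r|
    rewrite -E0 -E1; transitivity (p0 0 1 * (q0 0 0 * J 0 j + q0 0 1 * J 1 j) +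
     p1 0 1 * (q1 0 0 * J 0 j + q1 0 1 * J 1 j)); [ring|rewrite J0; ring]].
Qed.

(** The trace is computed in the basis [q0], [q1] with dual basis [p0], [p1]; the two summands will
    become those of b. *)
Lemma frame_tr M : \tr M = dotp p0 (q0 *m M) + dotp p1 (q1 *m M).
Proof.
have [_ [e00 e11 e01 e10]] := fr.
have ds := dual_basis_sum e00 e11 e01 e10.
have d00 : p0 0 0 * q0 0 0 + p1 0 0 * q1 0 0 = 1 by rewrite ds.
have d01 : p0 0 0 * q0 0 1 + p1 0 0 * q1 0 1 = 0 by rewrite ds.
have d10 : p0 0 1 * q0 0 0 + p1 0 1 * q1 0 0 = 0 by rewrite ds.
have d11 : p0 0 1 * q0 0 1 + p1 0 1 * q1 0 1 = 1 by rewrite ds.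
rewrite tr2 !dotp2 !mulmx2.
transitivity (M 0 0 * (p0 0 0 * q0 0 0 + p1 0 0 * q1 0 0) +
  M 0 1 * (p0 0 1 * q0 0 0 + p1 0 1 * q1 0 0) +
  M 1 0 * (p0 0 0 * q0 0 1 + p1 0 0 * q1 0 1) +
  M 1 1 * (p0 0 1 * q0 0 1 + p1 0 1 * q1 0 1)); last by ring.
by rewrite d00 d01 d10 d11; ring.
Qed.

(** The left side is tr(adj(J) M), the derivative of det at J in the direction M. As J = p1^T q0 has
    trace 0, adj(J) = - J, and tr(J M) is the pairing of [p1] with [q0 *m M]. *)
Lemma frame_det_diff M :
  M 0 0 * J 1 1 + J 0 0 * M 1 1 - (M 0 1 * J 1 0 + J 0 1 * M 1 0) =
  - dotp p1 (q0 *m M).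
Proof.
have [_ [_ _ + _]] := fr; rewrite dotp2 => e.
rewrite dotp2 !mulmx2 !frameE.
have e1 : p1 0 1 * q0 0 1 = - (q0 0 0 * p1 0 0).
  by rewrite [LHS]mulrC -[RHS]addr0 -e; ring.
have e2 : p1 0 0 * q0 0 0 = - (q0 0 1 * p1 0 1).
  by rewrite [LHS]mulrC -[RHS]addr0 -e; ring.
by rewrite e1 e2; ring.
Qed.

End Frame.

(** Trace and determinant zero force J^2 = 0, so a vector outside the kernel is sent to a nonzero
    multiple of [u]; rescaling it gives [q1]. The relations of [p0] and [p1] with the transpose are
    checked by pairing with the basis [u], [q1]. *)
Lemma rank1_nilpotent_frame J u : \tr J = 0 -> \det J = 0 -> J != 0 ->
  u != 0 -> u *m J = 0 ->
  \rank J = 1%N /\ exists q1 p0 p1, BT_frame J u q1 p0 p1.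
Proof.
move=> tJ dJ J0 u0 uJ.
have rJ : \rank J = 1%N.
  apply/eqP; rewrite eqn_leq lt0n mxrank_eq0 J0 andbT.
  rewrite -ltnS ltn_neqAle rank_leq_row andbT -/(row_free J) row_free_unit.
  by rewrite unitmxE dJ unitr0.
have ker w : w *m J = 0 -> exists c, w = c *: u.
  move=> wJ; apply/sub_rVP.
  have uk : (u <= kermx J)%MS by apply/sub_kermxP.
  apply: (@submx_trans _ _ _ _ _ _ (kermx J)); first exact/sub_kermxP.
  have := mxrank_leqif_sup uk; rewrite rank_rV u0 mxrank_ker rJ.
  by move=> [_]; rewrite eqxx => <-.
have JJ : J *m J = 0.
  have t : J 1 1 = - J 0 0 by apply/eqP; rewrite -addr_eq0 addrC -tr2 tJ.
  move: dJ; rewrite det2 t => dJ.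
  apply/row_matrixP => i; rewrite row0 row_mul.
  have [->|->] : i = 0 \/ i = 1.
    by case: i => -[|[|//]] ?; [left|right]; apply/val_inj.
  - apply: row2P; rewrite mulmx2 !mxE ?t; last ring.
    by rewrite -[RHS]oppr0 -dJ; ring.
  - apply: row2P; rewrite mulmx2 !mxE ?t; first ring.
    by rewrite -[RHS]oppr0 -dJ; ring.
split=> //.
have [z zJ] : exists z : 'rV[R]_2, z *m J != 0.
  apply: contrapT => /forallNP zJ; move/negP: J0; apply; apply/eqP.
  apply/row_matrixP => i; rewrite row0 rowE.
  by have /negP := zJ (delta_mx 0 i); rewrite negbK => /eqP.
have [c zJc] : exists c, z *m J = c *: u by apply: ker; rewrite -mulmxA JJ mulmx0.
have c0 : c != 0 by apply: contraNneq zJ => c0; rewrite zJc c0 scale0r.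
pose q1 := c^-1 *: z.
have q1J : q1 *m J = u by rewrite /q1 -scalemxAl zJc scalerA mulVf // scale1r.
(* The determinant of the rows [u], [q1]. Were it zero, [q1] would be a multiple of [u], and
   [u = q1 *m J] would vanish. *)
pose d := u 0 0 * q1 0 1 - u 0 1 * q1 0 0.
have d0 : d != 0.
  apply/eqP => d0; have : exists c', q1 = c' *: u.
    have [u00|u00] := eqVneq (u 0 0) 0.
      have u01 : u 0 1 != 0.
        by apply: contraNneq u0 => u01; apply/eqP/row2P; rewrite ?u00 ?u01 mxE.
      exists (q1 0 1 / u 0 1); apply: row2P; rewrite [in RHS]mxE ?divfK //.
      move: d0; rewrite /d u00 mul0r sub0r mulr0 => /eqP.
      by rewrite oppr_eq0 mulf_eq0 (negbTE u01) => /eqP.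
    exists (q1 0 0 / u 0 0); apply: row2P; rewrite [in RHS]mxE ?divfK //.
    apply: (mulfI u00); move/eqP: d0; rewrite /d subr_eq0 => /eqP ->.
    by field.
  move=> [c' q1E]; move: u0; rewrite -q1J q1E -scalemxAl uJ scaler0.
  by rewrite eqxx.
(* [p0] and [p1] are the columns of the inverse of the matrix with rows [u], [q1]. *)
pose p0 : 'rV[R]_2 := \row_j (if j == 0 then q1 0 1 / d else - q1 0 0 / d).
pose p1 : 'rV[R]_2 := \row_j (if j == 0 then - u 0 1 / d else u 0 0 / d).
have p00 : p0 0 0 = q1 0 1 / d by rewrite mxE.
have p01 : p0 0 1 = - q1 0 0 / d by rewrite mxE.
have p10 : p1 0 0 = - u 0 1 / d by rewrite mxE.
have p11 : p1 0 1 = u 0 0 / d by rewrite mxE.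
have e00 : dotp u p0 = 1.
  by rewrite dotp2 p00 p01 -[RHS](mulfV d0) /d; ring.
have e11 : dotp q1 p1 = 1.
  by rewrite dotp2 p10 p11 -[RHS](mulfV d0) /d; ring.
have e01 : dotp u p1 = 0 by rewrite dotp2 p10 p11; ring.
have e10 : dotp q1 p0 = 0 by rewrite dotp2 p00 p01; ring.
have ds := dual_basis_sum e00 e11 e01 e10.
have dual v w : dotp u v = dotp u w -> dotp q1 v = dotp q1 w -> v = w.
  move=> Eu Eq.
  have vE (x : 'rV[R]_2) j : x 0 j = p0 0 j * dotp u x + p1 0 j * dotp q1 x.
    rewrite !dotp2; have D0 := ds j 0; have D1 := ds j 1.
    transitivity ((j == 0)%:R * x 0 0 + (j == 1)%:R * x 0 1).
      have [->|->] : j = 0 \/ j = 1.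
        by case: j {D0 D1} => -[|[|//]] ?; [left|right]; apply/val_inj.
      + by rewrite eqxx (_ : (0 == 1 :> 'I_2) = false) // mul1r mul0r addr0.
      + by rewrite eqxx (_ : (1 == 0 :> 'I_2) = false) // mul1r mul0r add0r.
    by rewrite -D0 -D1; ring.
  by apply/rowP => j; rewrite vE [RHS]vE Eu Eq.
have dotp0 (x : 'rV[R]_2) : dotp x 0 = 0 by rewrite dotp2 !mxE !mulr0 addr0.
have dot0p (x : 'rV[R]_2) : dotp 0 x = 0 by rewrite dotpC dotp0.
exists q1, p0, p1; split; last by [].
split=> //.
- apply/andP; split; first exact/sub_kermxP.
  apply/row_subP => i; apply/sub_rVP/ker/sub_kermxP; exact: row_sub.
- by apply: dual; rewrite dotp_mul_tr ?uJ ?q1J dotp0 ?dot0p.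
- by apply: dual; rewrite dotp_mul_tr ?uJ ?q1J ?dot0p ?e01 ?e00 ?e11.
Qed.

End Frames.

(** * Trace and determinant of the linear part along the kernel direction *)

Section BogdanovTakens.
Context {R : realType} (r : nat).
Let V := ('rV[R]_2 * 'rV[R]_r)%type.
Variables (X : V -> 'rV[R]_2).
Hypothesis XC : Cinfty setT X.
Implicit Types (q : V) (u v : 'rV[R]_2).

Lemma diff_slice (W : normedModType R) (g : V -> W) (x : 'rV[R]_2)
    (l : 'rV[R]_r) : differentiable g ((x, l) : V) ->
  differentiable (fun x : 'rV[R]_2 => g (x, l)) x /\
  forall u, 'd (fun x : 'rV[R]_2 => g (x, l)) x u = 'd g ((x, l) : V) (u, 0).
Proof.
move=> dg; pose s (x : 'rV[R]_2) : V := (x, l).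
have ds : is_diff x s (fun u => (u, 0)).
  exact: (@is_diff_pair _ _ _ _ id id (cst l) 0).
have dsx : differentiable s x by case: ds.
have dgs : differentiable g (s x) by [].
split; first exact: (differentiable_comp dsx dgs).
move=> u; have E := congr1 (@^~ u) (diff_comp dsx dgs).
apply: (eq_trans E) => /=.
by have [_ ->] := ds.
Qed.

Lemma derive_slice (W : normedModType R) (g : V -> W) (x : 'rV[R]_2)
    (l : 'rV[R]_r) u : differentiable g ((x, l) : V) ->
  'D_u (fun x : 'rV[R]_2 => g (x, l)) x = 'D_((u, 0) : V) g ((x, l) : V).
Proof.
move=> dg; have [d1 E] := diff_slice dg.
by rewrite (deriveE _ d1) (deriveE _ dg) E.
Qed.

Lemma diff_lincomb (f g : V -> R) (a b : R) q (w : V) : differentiable f q ->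
  differentiable g q ->
  'd (fun x => a * f x + b * g x) q w = a * 'd f q w + b * 'd g q w.
Proof.
move=> df dg.
have dd := differentiableD (differentiableZ a df) (differentiableZ b dg).
have isd (h : V -> R) : differentiable h q -> is_derive q w h ('d h q w).
  by move=> dh; rewrite -(deriveE w dh); exact/derivableP/diff_derivable.
have [_ E] := is_deriveD (is_deriveZ a (isd _ df)) (is_deriveZ b (isd _ dg)).
exact: (eq_trans (esym (deriveE w dd)) E).
Qed.

Lemma diff_det_fun (f g h k : V -> R) q (w : V) : differentiable f q ->
  differentiable g q -> differentiable h q -> differentiable k q ->
  'd (fun x => f x * g x - h x * k x) q w =
  'd f q w * g q + f q * 'd g q w - ('d h q w * k q + h q * 'd k q w).
Proof.
move=> df dg dh dk.
have dd := differentiableB (differentiableM df dg) (differentiableM dh dk).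
have isd (a : V -> R) : differentiable a q -> is_derive q w a ('d a q w).
  by move=> da; rewrite -(deriveE w da); exact/derivableP/diff_derivable.
have [_ E] := is_deriveB (is_deriveM (isd _ df) (isd _ dg))
  (is_deriveM (isd _ dh) (isd _ dk)).
have arith (a b c d a' b' c' d' : R) :
    a *: b' + b *: a' - (c *: d' + d *: c') = a' * b + a * b' - (c' * d + c * d').
  by rewrite /GRing.scale /=; ring.
exact: (eq_trans (esym (deriveE w dd)) (eq_trans E (arith _ _ _ _ _ _ _ _))).
Qed.

Lemma X_differentiable q : differentiable X q.
Proof. exact: Cinfty_differentiable XC (I : setT q). Qed.

Lemma mul_DxX q u : u *m DxX X q = 'd X q (u, 0).
Proof.
by case: q => x l; have [_ E] := diff_slice (X_differentiable (x, l)); rewrite /DxX -jacobianE E.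
Qed.

Lemma DxXE i j : (fun q => DxX X q i j) =
  (fun y => ('D_(delta_mx 0 i : 'rV[R]_2, 0 : 'rV[R]_r) X y) 0 j).
Proof.
by apply/funext => q; rewrite (deriveE _ (X_differentiable q)) -mul_DxX -rowE [RHS]mxE.
Qed.

Lemma DxX_Cinfty i j : Cinfty setT (fun q => DxX X q i j).
Proof.
move=> k; rewrite DxXE; apply: (Ck_coord 0 j openT); exact: (Cinfty_derive _ XC).
Qed.

Lemma trX_Cinfty : Cinfty setT (trX X).
Proof.
move=> k; have sC := CkD openT (@DxX_Cinfty 0 0 k) (@DxX_Cinfty 1 1 k).
by apply: (Ck_eq openT _ sC) => q _; rewrite /trX tr2.
Qed.

Lemma detX_Cinfty : Cinfty setT (detX X).
Proof. by move=> k; apply: (Ck_det openT) => i j; exact: DxX_Cinfty. Qed.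

Definition dDxX q u : 'M[R]_2 :=
  \matrix_(i, j) 'd (fun q => DxX X q i j) q (u, 0).

(** The inner derivative along [v] is [v *m DxX X], so the outer one along [u] acts on the matrix
    only. Second derivatives thereby become entries of the derivative of D_xX, on which trace and
    determinant depend. *)
Lemma D2xXE q u v : D2xX X q u v = v *m dDxX q u.
Proof.
have dD (w : V) : differentiable ('D_w X) q.
  exact: Cinfty_differentiable (Cinfty_derive w XC) (I : setT q).
case: q dD => x l dD; rewrite /D2xX /=.
have -> : 'D_v (fun x : 'rV[R]_2 => X (x, l)) =
    (fun x : 'rV[R]_2 => 'D_((v, 0) : V) X ((x, l) : V)).
  by apply/funext => y; rewrite (derive_slice v (X_differentiable (y, l))).
rewrite (derive_slice u (dD _)) (deriveE _ (dD _)).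
apply/rowP => j; rewrite (diff_coord _ _ (dD _)) mulmx2 ![dDxX _ _ _ _]mxE.
have dj i := Cinfty_differentiable (DxX_Cinfty i j) (I : setT ((x, l) : V)).
have DE (y : V) :
    ('D_((v, 0) : V) X y) 0 j = v 0 0 * DxX X y 0 j + v 0 1 * DxX X y 1 j.
  by rewrite (deriveE _ (X_differentiable y)) -mul_DxX mulmx2.
rewrite (funext DE).
exact: (diff_lincomb _ _ _ (dj 0) (dj 1)).
Qed.

Lemma diff_trX q u : 'd (trX X) q (u, 0) = \tr (dDxX q u).
Proof.
have d00 := Cinfty_differentiable (DxX_Cinfty 0 0) (I : setT q).
have d11 := Cinfty_differentiable (DxX_Cinfty 1 1) (I : setT q).
have -> : trX X = (fun q => DxX X q 0 0) + (fun q => DxX X q 1 1).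
  by apply/funext => x; rewrite /trX tr2.
by rewrite diffD //= tr2 !mxE.
Qed.

Lemma diff_detX q u : 
    let J := DxX X q in let M := dDxX q u in
  'd (detX X) q (u, 0) =
  M 0 0 * J 1 1 + J 0 0 * M 1 1 - (M 0 1 * J 1 0 + J 0 1 * M 1 0).
Proof.
have dA i j := Cinfty_differentiable (DxX_Cinfty i j) (I : setT q).
have dE (x : V) : detX X x =
    DxX X x 0 0 * DxX X x 1 1 - DxX X x 0 1 * DxX X x 1 0 by exact: det2.
rewrite /= (funext dE) ![dDxX _ _ _ _]mxE.
exact: (diff_det_fun _ (dA 0 0) (dA 1 1) (dA 0 1) (dA 1 0)).
Qed.

Lemma BT_diff q (q0 q1 p0 p1 : 'rV[R]_2) : BT_frame (DxX X q) q0 q1 p0 p1 ->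
  'd (detX X) q (q0, 0) = - (2 * BT_a X q q0 p1) /\
  'd (trX X) q (q0, 0) = BT_b X q q0 q1 p0 p1.
Proof.
move=> fr; rewrite diff_detX diff_trX (frame_det_diff fr) (frame_tr fr).
by rewrite /BT_a /BT_b !D2xXE mulrA mulfV ?mul1r // pnatr_eq0.
Qed.

Lemma diff_projpi q w : 'd (@projpi R r) q w = w.2.
Proof.
have := diff_lin q (@sndl_continuous R 'rV[R]_2 'rV[R]_r).
by move=> E; exact: (congr1 (@^~ w) E).
Qed.

End BogdanovTakens.

(** * Fold normal form *)

Section Split0.
Context {R : realType} (n : nat).
Let W := 'rV[R]_n.+1.

(** With [drop0] and [keep0] as the two linear maps, [seg u y] is [(u y_0, y')], the path from
    [(0, y')] to [y]. *)
Definition drop0 (y : W) : W := \row_j (if j == 0 then 0 else y 0 j).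
Definition keep0 (y : W) : W := \row_j (if j == 0 then y 0 j else 0).
Lemma drop0_linear : linear drop0.
Proof.
by move=> a u v; apply/rowP => j; rewrite !mxE; case: eqP; rewrite ?mulr0 ?addr0.
Qed.
Lemma keep0_linear : linear keep0.
Proof.
by move=> a u v; apply/rowP => j; rewrite !mxE; case: eqP; rewrite ?mulr0 ?addr0.
Qed.
Definition drop0l : {linear W -> W} :=
  HB.pack drop0 (GRing.isLinear.Build R W W _ _ drop0_linear).
Definition keep0l : {linear W -> W} :=
  HB.pack keep0 (GRing.isLinear.Build R W W _ _ keep0_linear).

Lemma drop0_keep0 y : drop0 y + keep0 y = y.
Proof. by apply/rowP => j; rewrite !mxE; case: eqP; rewrite ?addr0 ?add0r. Qed.

Lemma keep0E y : keep0 y = y 0 0 *: delta_mx 0 0.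
Proof.
by apply/rowP => j; rewrite !mxE eqxx /=; case: eqP => [->|_]; rewrite ?mulr1 ?mulr0.
Qed.

Lemma seg0E u y : seg drop0l keep0l u y 0 0 = u * y 0 0.
Proof. by rewrite !mxE add0r. Qed.

(** In the maximum norm, shrinking one coordinate cannot leave a ball centred at 0. *)
Lemma seg_stable_ball (d : R) : seg_stable drop0l keep0l (ball (0 : W) d).
Proof.
move=> y u; rewrite -!ball_normE /= !sub0r !normrN => yd /andP[u0 u1].
apply: le_lt_trans yd; apply: rV_norm_le => // j; rewrite !mxE.
case: eqP => _; last by rewrite mulr0 addr0; exact: rV_coord_norm_le.
rewrite add0r normrM (ger0_norm u0); apply: le_trans (rV_coord_norm_le y j).
by rewrite ler_piMl.
Qed.

End Split0.

Section Products.
Context {R : realType}.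

Lemma affine_diff (V W : normedModType R) (L : {linear V -> W}) c x :
  continuous L -> differentiable (fun y => L y + c) x /\
  forall w, 'd (fun y => L y + c) x w = L w.
Proof.
move=> Lc; suff [dL LE] : differentiable (fun y => L y + c) x /\
  'd (fun y => L y + c) x = L :> (V -> W) by split=> // w; rewrite LE.
apply: diff_epsP => // e e0; near=> h.
have -> : L (h + x) + c - (L x + c) - L h = 0.
  by rewrite linearD opprD addrACA subrr addr0 addrK subrr.
by rewrite normr0 mulr_ge0 ?(ltW e0).
Unshelve. all: by end_near. Qed.

Lemma Ck_dotp (V : normedModType R) n k (U : set V) (f g : V -> 'rV[R]_n) :
  open U -> Ck k U f -> Ck k U g -> Ck k U (fun x => dotp (f x) (g x)).
Proof.
move=> oU fC gC; apply: (Ck_sum oU) => i.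
by apply: (CkM oU); exact: Ck_coord.
Qed.

Lemma diff_mul0 (V : normedModType R) (f g : V -> R) x v : f x = 0 ->
  differentiable f x -> differentiable g x ->
  'd (fun y => f y * g y) x v = g x * 'd f x v.
Proof.
move=> f0 df dg; have dd := differentiableM df dg.
have isd (h : V -> R) : differentiable h x -> is_derive x v h ('d h x v).
  by move=> dh; rewrite -(deriveE v dh); exact/derivableP/diff_derivable.
have [_ E] := is_deriveM (isd _ df) (isd _ dg).
apply: (eq_trans (esym (deriveE v dd)) (eq_trans E _)).
by rewrite f0 scale0r add0r.
Qed.

Lemma diff_sub_scale (V : normedModType R) (a : R) (f g : V -> R) x v :
  differentiable f x -> differentiable g x ->
  'd (fun y => a * (f y - g y)) x v = a * ('d f x v - 'd g x v).
Proof.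
move=> df dg; have dd := differentiableZ a (differentiableB df dg).
have isd (h : V -> R) : differentiable h x -> is_derive x v h ('d h x v).
  by move=> dh; rewrite -(deriveE v dh); exact/derivableP/diff_derivable.
have [_ E] := is_deriveZ a (is_deriveB (isd _ df) (isd _ dg)).
exact: (eq_trans (esym (deriveE v dd)) E).
Qed.

Lemma dotpDl n (u v w : 'rV[R]_n) : dotp (u + v) w = dotp u w + dotp v w.
Proof. by rewrite /dotp -big_split; apply: eq_bigr => i _; rewrite mxE mulrDl. Qed.

Lemma dotpZl n a (u w : 'rV[R]_n) : dotp (a *: u) w = a * dotp u w.
Proof. by rewrite /dotp mulr_sumr; apply: eq_bigr => i _; rewrite mxE mulrA. Qed.

End Products.

Section Fold.
Context {R : realType} (r : nat).
Let N := 'rV[R]_r.+1.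
Let V := ('rV[R]_2 * N)%type.
Variables (X w : V -> 'rV[R]_2) (D : V -> R) (q : V) (q0 z : 'rV[R]_2)
  (i0 : 'I_r.+1).
Hypotheses (XC : Cinfty setT X) (DC : Cinfty setT D) (wC : Cinfty setT w).
Hypotheses (Xq : X q = 0) (Dq : D q = 0).
Hypothesis kerX : forall u : 'rV[R]_2, 'd X q ((u, 0) : V) = 0 ->
  exists c, u = c *: q0.
Hypothesis Dq0 : 'd D q ((q0, 0) : V) != 0.
(* In the application w x is p0 (adj D_xX(x))^T, so that wX expresses
   J adj J = det J, and z is p0. *)
Hypothesis wX : forall x (u : 'rV[R]_2),
  dotp ('d X x ((u, 0) : V)) (w x) = D x * dotp u z.
(** Since [w q] is [- p1] in the application, this selects a parameter along which the derivative of
    X leaves the image of D_xX(q). *)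
Hypothesis wi0 : dotp ('d X q ((0, delta_mx 0 i0) : V)) (w q) != 0.
Hypothesis q0z : dotp q0 z != 0.

Let dXT x : differentiable X x.
Proof. exact: Cinfty_differentiable XC (I : setT x). Qed.
Let dDT x : differentiable D x.
Proof. exact: Cinfty_differentiable DC (I : setT x). Qed.

Let s (j : 'I_r.+1) : 'I_r.+1 := tperm 0 i0 j.

Let s0 : s 0 = i0. Proof. exact: tpermL. Qed.

Let sK : involutive s. Proof. by move=> j; rewrite /s tpermK. Qed.

(* [cen] lists the parameters in the order that puts the i0-th one first,
   centred at q; in the chart [Psi] of E that first entry is replaced by D. *)
Let pcoord (k : 'I_r.+1) : {linear V -> R} :=
  [the {linear V -> R} of coordl 0 k \o sndl 'rV[R]_2 N].

Let pcoord_continuous k : continuous (pcoord k).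
Proof. by apply: findim_linear_continuous; exact: findim_rV2. Qed.

Let cen (j : 'I_r.+1) (x : V) : R := pcoord (s j) x + - q.2 0 (s j).

Let Psi (x : V) : N := \row_j (if j == 0 then D x else cen j x).

Let cenC j : Cinfty setT (cen j).
Proof.
move=> k; apply: (CkD openT); last exact: Ck_cst.
exact: (Ck_linear _ _ (@pcoord_continuous (s j))).
Qed.

Let PsiC : Cinfty setT Psi.
Proof.
move=> k; apply: (Ck_row openT) => j; have [->|j0] := eqVneq j 0.
  by apply: (Ck_eq openT _ (DC k)) => x _; rewrite mxE.
by apply: (Ck_eq openT _ (@cenC j k)) => x _; rewrite mxE (negbTE j0).
Qed.

Let Psi_q : Psi q = 0.
Proof. by apply/rowP => j; rewrite !mxE; case: eqP => // _; exact: subrr. Qed.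

Let support_i0 (mu : N) : (forall j, j != 0 -> mu 0 (s j) = 0) ->
  mu = mu 0 i0 *: delta_mx 0 i0.
Proof.
move=> mu0; apply/rowP => k; rewrite !mxE eqxx /=.
have [->|ki0] := eqVneq k i0; first by rewrite mulr1.
rewrite mulr0 -(sK k) mu0 //; apply: contraNneq ki0 => sk0.
by rewrite -(sK k) sk0 s0.
Qed.

(** Pairing with [w x] turns the singular block D_xX into multiplication by [D x]. At q, where D
    vanishes, the relation kills the i0-th component; along a chart of E it exhibits the factor D in
    that component. *)
Let diffX_split x (v : V) : (forall j, j != 0 -> v.2 0 (s j) = 0) ->
  'd X x v = 0 ->
  D x * dotp v.1 z + v.2 0 i0 * dotp ('d X x ((0, delta_mx 0 i0) : V)) (w x) = 0.
Proof.
move=> v0 Xv; rewrite -wX -dotpZl -dotpDl -linearZ -linearD.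
have -> : ((v.1, 0) : V) + v.2 0 i0 *: ((0, delta_mx 0 i0) : V) = v.
  case: v v0 {Xv} => u mu /= /support_i0 {2}->.
  by congr pair; rewrite /= ?scaler0 ?addr0 ?add0r.
by rewrite Xv /dotp big1 // => i _; rewrite mxE mul0r.
Qed.

(** At q the parameter part of [v] vanishes by the previous relation, so [v] is a multiple of
    [(q0, 0)], on which ['d D q] is nonzero. Both charts of E below rest on this. *)
Let X_inj (v : V) : (forall j, j != 0 -> v.2 0 (s j) = 0) -> 'd X q v = 0 ->
  'd D q v = 0 -> v = 0.
Proof.
move=> v0 Xv; have := diffX_split v0 Xv; rewrite Dq mul0r add0r => /eqP.
rewrite mulf_eq0 (negbTE wi0) orbF => /eqP vi0.
have v2 : v.2 = 0 by rewrite (support_i0 v0) vi0 scale0r.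
have vE : v = (v.1, 0) :> V by rewrite -v2; case: (v).
rewrite vE in Xv *; have [c ->] := kerX Xv.
have -> : (c *: q0, 0) = c *: ((q0, 0) : V) by congr pair; rewrite /= scaler0.
rewrite linearZ => /eqP; rewrite mulf_eq0 (negbTE Dq0) orbF => /eqP ->.
by rewrite scale0r.
Qed.

(* The remaining parameter lambda_i0 as a function on the chart. *)
Let F (psi : N -> V) (y : N) : R := cen 0 (psi y).

Lemma fold_division (psi : N -> V) (Y : set N) : open Y -> Y 0 ->
  Cinfty Y psi -> psi 0 = q -> (forall y, Y y -> X (psi y) = 0) ->
  (forall y, Y y -> Psi (psi y) = y) ->
  exists d G, [/\ 0 < d, ball 0 d `<=` Y, Cinfty (ball (0 : N) d) G, G 0 != 0 &
    forall y, ball 0 d y -> F psi y - F psi (drop0 y) = y 0 0 ^+ 2 * G y].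
Proof.
move=> oY Y0 psiC psi0 Xpsi Psipsi.
have fV : findim V by exact: findim_rV2.
have dpsi y : Y y -> differentiable psi y by exact: Cinfty_differentiable psiC.
pose e0 : N := delta_mx 0 0.
pose Dpsi y := 'D_e0 psi y.
have clc k : continuous (coordl 0 k : N -> R) by exact: coord_continuous.
have dcomp (W : normedModType R) (f : V -> W) y : Y y ->
    differentiable f (psi y) -> 'd f (psi y) (Dpsi y) = 'D_e0 (f \o psi) y.
  move=> Yy df; have dc := differentiable_comp (dpsi _ Yy) df.
  rewrite /Dpsi (deriveE _ dc) (deriveE _ (dpsi _ Yy)).
  exact: (esym (congr1 (@^~ e0) (diff_comp (dpsi _ Yy) df))).
have dX0 y : Y y -> 'd X (psi y) (Dpsi y) = 0.
  move=> Yy; rewrite dcomp // -[RHS](derive_cst (0 : 'rV[R]_2) y e0).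
  apply: near_eq_derive; apply: (open_near_eq oY Yy) => y' Yy' /=; exact: Xpsi.
have dD1 y : Y y -> 'd D (psi y) (Dpsi y) = 1.
  move=> Yy; rewrite dcomp //.
  have <- : 'D_e0 (coordl 0 0 : N -> R) y = 1.
    rewrite deriveE; last exact: differentiable_coord.
    by rewrite (diff_lin _ (clc _)) /= mxE !eqxx.
  apply: near_eq_derive; apply: (open_near_eq oY Yy) => y' Yy' /=.
  by rewrite -[in RHS](Psipsi _ Yy') mxE.
have dcen j x v : differentiable (cen j) x /\ 'd (cen j) x v = v.2 0 (s j).
  have [d1 d2] := affine_diff (- q.2 0 (s j)) x (@pcoord_continuous (s j)).
  by split; [exact: d1|rewrite d2].
have mu0 y j : Y y -> j != 0 -> (Dpsi y).2 0 (s j) = 0.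
  move=> Yy j0; have [dc <-] := dcen j (psi y) (Dpsi y); rewrite dcomp //.
  have <- : 'D_e0 (coordl 0 j : N -> R) y = 0.
    rewrite deriveE; last exact: differentiable_coord.
    by rewrite (diff_lin _ (clc _)) /= mxE (negbTE j0) andbF.
  apply: near_eq_derive; apply: (open_near_eq oY Yy) => y' Yy' /=.
  by rewrite -[in RHS](Psipsi _ Yy') mxE (negbTE j0).
have FC : Cinfty Y (F psi).
  move=> k.
  have C0 := Ck_comp fV (@findim_R R) oY openT (fun _ _ => I) (psiC k) (@cenC 0 k).
  exact: C0.
have dF y : Y y -> 'D_e0 (F psi) y = (Dpsi y).2 0 i0.
  move=> Yy; have [dc E] := dcen 0 (psi y) (Dpsi y).
  by rewrite -[LHS](dcomp _ _ _ Yy dc) E s0.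
pose kap (x : V) := dotp ('D_((0, delta_mx 0 i0) : V) X x) (w x).
have kapC : Cinfty setT kap.
  move=> k; apply: (Ck_dotp openT) (wC k); exact: Cinfty_derive.
have kapE x : kap x = dotp ('d X x ((0, delta_mx 0 i0) : V)) (w x).
  by rewrite /kap deriveE.
have kappsiC : Cinfty Y (kap \o psi).
  move=> k.
  exact: (Ck_comp fV (@findim_R R) oY openT (fun _ _ => I) (psiC k) (kapC k)).
(* A ball, so as to contain the paths from [drop0 y] to [y], and so small that the denominator [kap]
   does not vanish on it. *)
have [d d0 dY] : exists2 d : R, 0 < d &
    ball (0 : N) d `<=` Y `&` [set y | kap (psi y) != 0].
  have N1 : \forall y \near (0 : N), Y y by exact: open_nbhs_nbhs.
  have N2 : \forall y \near (0 : N), kap (psi y) != 0.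
    have := Cinfty_continuous kappsiC Y0; rewrite /prop_for /continuous_at /= psi0.
    by move/cvgr_neq0; apply; rewrite kapE.
  by have [d /= d0 dB] := (nbhs_ballP _ _).1 (filterI N1 N2); exists d.
pose B := ball (0 : N) d.
have oB : open B by exact: ball_open.
have BY : B `<=` Y by move=> y /dY[].
have kap0 y : B y -> kap (psi y) != 0 by move=> /dY[].
(* Solves the relation of [diffX_split] at [Dpsi y] for the i0-th component, the factor
   [D (psi y) = y 0 0] being split off. *)
pose k (y : N) := - (dotp (Dpsi y).1 z * (kap (psi y))^-1).
have kC : Cinfty B k.
  move=> m; apply: (CkN oB); apply: (CkM oB).
    apply: (Ck_dotp oB); last exact: Ck_cst.
    apply: (Ck_linear_comp oB (L := fstl 'rV[R]_2 N)); first exact: fstl_continuous.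
    exact: (Ck_sub BY (Cinfty_derive _ psiC m)).
  by apply: (CkV oB kap0); exact: (Ck_sub BY (kappsiC m)).
have dFk y : B y -> 'D_e0 (F psi) y = y 0 0 * k y.
  move=> By; have Yy := BY _ By; rewrite dF //.
  have := diffX_split (fun j => @mu0 y j Yy) (dX0 _ Yy); rewrite -kapE.
  have -> : D (psi y) = y 0 0 by rewrite -[in RHS](Psipsi _ Yy) mxE.
  move=> E; apply: (mulIf (kap0 _ By)); rewrite /k.
  rewrite mulrN mulNr mulrA divfK ?kap0 //.
  by apply/eqP; rewrite -addr_eq0 addrC E.
(* At 0 the velocity of [psi] has no parameter part, so it is [c *: q0] in the first factor; [c] is
   nonzero because D has derivative 1 along it. *)
have k0 : k 0 != 0.
  have B0 : B 0 by exact: ballxx.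
  have mi0 : (Dpsi 0).2 0 i0 = 0 by rewrite -dF // dFk // mxE mul0r.
  have mu : (Dpsi 0).2 = 0.
    by rewrite (support_i0 (fun j => @mu0 0 j Y0)) mi0 scale0r.
  have DE : Dpsi 0 = ((Dpsi 0).1, 0) by move: mu; case: (Dpsi 0) => a b /= ->.
  have := dX0 _ Y0; rewrite psi0 DE => /kerX[c cE].
  have c0 : c != 0.
    have := dD1 _ Y0; rewrite psi0 DE cE => D1; apply/eqP => c0; move: D1.
    rewrite c0 scale0r (_ : (0, 0) = 0 :> V) // linear0 => /eqP.
    by rewrite eq_sym oner_eq0.
  rewrite /k oppr_eq0 cE dotpZl !mulf_neq0 // invr_neq0 //; exact: kap0.
have sB : seg_stable (@drop0l R r) (@keep0l R r) B by exact: seg_stable_ball.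
have fN : findim N by exact: findim_rV.
(* The exponent 1 is the factor u in d_0 F(u y_0, y') = u y_0 k(u y_0, y'). The second factor y_0 of
   the square comes from the velocity of the path. *)
exists d, (pint (@drop0l R r) (@keep0l R r) 1 k); split=> //.
- by apply: pint_Cinfty.
- have half : int01 (fun u : R => u) = 2^-1.
    have idc : cont01 (fun u : R => u) by move=> u _; exact: cvg_id.
    have dsq (u : R) : 0 <= u <= 1 -> is_derive u 1 (fun u : R => u ^+ 2 / 2) u.
      move=> _; have -> : (fun u : R => u ^+ 2 / 2) = 2^-1 \*: (id ^+ 2 : R -> R).
        by apply/funext => t; rewrite mulrC.
      apply: is_derive_eq.
      by rewrite /GRing.scale /= expr1 mulr1 mulrA mulVf ?mul1r.
    by rewrite (int01_FTC idc dsq) expr1n expr0n /= mul0r subr0 mul1r.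
  have -> : pint (@drop0l R r) (@keep0l R r) 1 k 0 = k 0 / 2.
    rewrite -half -int01Z; last by move=> u _; exact: cvg_id.
    apply: eq_int01 => u _; rewrite expr1 mulrC; congr (k _ * _).
    by apply/rowP => j; rewrite !mxE; case: eqP => _; rewrite ?mulr0 ?addr0.
  by rewrite mulf_neq0 // invr_neq0.
- move=> y By.
  have FTCy := seg_FTC sB (Cinfty_sub BY FC) By.
  rewrite -{1}(drop0_keep0 y) FTCy.
  have c1 : cont01 (fun u => u ^+ 1 * k (seg (@drop0l R r) (@keep0l R r) u y)).
    exact: (cont01_int sB kC By).
  rewrite /pint -int01Z //; apply: eq_int01 => u u01.
  have Bs : B (seg (@drop0l R r) (@keep0l R r) u y) by exact: sB.
  have dFs : differentiable (F psi) (seg (@drop0l R r) (@keep0l R r) u y).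
    exact: (Cinfty_differentiable FC (BY _ Bs)).
  set y' := seg _ _ u y in Bs dFs *.
  have dZ (c : R) v : 'd (F psi) y' (c *: v) = c * 'd (F psi) y' v.
    by rewrite linearZ.
  have y'0 : y' 0 0 = u * y 0 0 by exact: seg0E.
  rewrite (deriveE _ dFs) /= keep0E dZ -(deriveE _ dFs) dFk // y'0 expr1.
  by ring.
Qed.

Let permc (l : N) : N := \row_j l 0 (s j).
Let permc_linear : linear permc.
Proof. by move=> a u v; apply/rowP => j; rewrite !mxE. Qed.
Let perml : {linear N -> N} :=
  HB.pack permc (GRing.isLinear.Build R N N _ _ permc_linear).
Let dropl : {linear N -> N} := [the {linear N -> N} of @drop0l R r \o perml].

Theorem fold_normal_form :
  whitney_fold r.+1 [set x | X x = 0] [set: N] (@projpi R r.+1) q.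
Proof.
have fV : findim V by exact: findim_rV2.
have fN : findim N by exact: findim_rV.
have diffcen j x v : 'd (cen j) x v = v.2 0 (s j).
  by have [_ ->] := affine_diff (- q.2 0 (s j)) x (@pcoord_continuous (s j)).
have injPsi v : 'd X q v = 0 -> 'd Psi q v = 0 -> v = 0.
  have dPsi : differentiable Psi q by exact: Cinfty_differentiable PsiC (I : setT q).
  have PsiE j : ('d Psi q v) 0 j = if j == 0 then 'd D q v else v.2 0 (s j).
    rewrite (diff_coord _ _ dPsi); have [->|j0] := eqVneq j 0.
      by congr ('d _ q v); apply/funext => x; rewrite mxE.
    rewrite -(diffcen j q); congr ('d _ q v); apply/funext => x.
    by rewrite mxE (negbTE j0).
  move=> Xv Pv; have P0 j := PsiE j; rewrite Pv in P0.
  apply: X_inj => //.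
    by move=> j j0; have := P0 j; rewrite (negbTE j0) mxE.
  by have := P0 0; rewrite eqxx mxE.
have [B1 [psi [_ c1 oY psiC psiK]]] :=
  level_chart openT (I : setT q) Xq XC PsiC injPsi.
have [[_ oB1 B1q _ _] _] := c1.
set Y := Psi @` _ in oY psiC.
have Y0 : Y 0 by exists q.
have psi0 : psi 0 = q by rewrite -Psi_q psiK //; apply/mem_set.
have psiY y : Y y -> X (psi y) = 0 /\ Psi (psi y) = y.
  by move=> [x Ex <-]; rewrite psiK //; [split=> //; case: Ex|exact/mem_set].
have [d [G [d0 dY GC G0 FG]]] := fold_division oY Y0 psiC psi0
  (fun y Yy => (psiY y Yy).1) (fun y Yy => (psiY y Yy).2).
pose B : set N := ball 0 d.
have oB : open B by exact: ball_open.
have B0 : B 0 by exact: ballxx.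
(* The sign makes [H] positive at 0, hence nearby, so that its square root is smooth; [eps]
   reappears in the target chart. *)
pose eps := Num.sg (G 0); pose H (y : N) := eps * G y.
have H0 : 0 < H 0 by rewrite /H -normrEsg normr_gt0.
have HC : Cinfty B H by move=> k; apply: (CkM oB) (GC k); exact: Ck_cst.
pose B3 := B `&` H @^-1` [set t | 0 < t].
have oB3 : open B3.
  have oP : open [set t : R | 0 < t] by exact: open_gt.
  exact: (open_preimage_in oB oP (fun y => @Cinfty_continuous _ _ _ _ _ y HC)).
have B30 : B3 0 by [].
pose S (y : N) := Num.sqrt (H y).
have SC : Cinfty B3 S.
  by move=> k; apply: (Ck_sqrt oB3) => [y []//|]; apply: Ck_sub (HC k) => y [].
pose W3 := setT `&` Psi @^-1` B3.
have oW3 : open W3.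
  apply: open_preimage_in oB3 _ => //; first exact: openT.
  by move=> x; exact: Cinfty_continuous.
have W3q : W3 q by split=> //; rewrite /= Psi_q.
pose phi (x : V) : N := \row_j (if j == 0 then D x * S (Psi x) else cen j x).
have SPC : Cinfty W3 (S \o Psi).
  move=> k; apply: (Ck_comp (U' := B3) fN (@findim_R R) oW3 oB3 _ _ (SC k)).
    by move=> x [].
  exact: Ck_sub (PsiC k).
have phiC : Cinfty W3 phi.
  move=> k; apply: (Ck_row oW3) => j; have [->|j0] := eqVneq j 0.
    have DSC := CkM oW3 (Ck_sub (@subsetT _ W3) (DC k)) (SPC k).
    by apply: (Ck_eq oW3 _ DSC) => x _; rewrite mxE.
  apply: (Ck_eq oW3 _ (Ck_sub (@subsetT _ W3) (@cenC j k))) => x _.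
  by rewrite mxE (negbTE j0).
have S0 : S 0 != 0 by rewrite gt_eqF // sqrtr_gt0.
have injphi v : 'd X q v = 0 -> 'd phi q v = 0 -> v = 0.
  have dphi : differentiable phi q by exact: Cinfty_differentiable phiC W3q.
  have phiE j : ('d phi q v) 0 j = if j == 0 then S 0 * 'd D q v else v.2 0 (s j).
    rewrite (diff_coord _ _ dphi); have [->|j0] := eqVneq j 0.
      have dS : differentiable (S \o Psi) q by exact: Cinfty_differentiable SPC W3q.
      have := diff_mul0 v Dq (dDT q) dS; rewrite /= Psi_q => <-.
      by congr ('d _ q v); apply/funext => x; rewrite mxE.
    rewrite -(diffcen j q); congr ('d _ q v); apply/funext => x.
    by rewrite mxE (negbTE j0).
  move=> Xv Pv; have P0 j := phiE j; rewrite Pv in P0.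
  apply: X_inj => //.
    by move=> j j0; have := P0 j; rewrite (negbTE j0) mxE.
  have := P0 0; rewrite eqxx mxE => /esym/eqP.
  by rewrite mulf_eq0 (negbTE S0) => /eqP.
(* [tau] keeps the parameters other than i0, so [F psi (tau l)] is the centred i0-th parameter of
   the point of the fold locus D = 0 over them. *)
pose tau (l : N) : N := dropl l + - dropl q.2.
pose mc0 (l : N) : R := coordl 0 i0 l + - q.2 0 i0.
pose mcj j (l : N) : R := coordl 0 (s j) l + - q.2 0 (s j).
have dlc : continuous dropl by exact: findim_linear_continuous.
have clc k : continuous (coordl 0 k : N -> R) by exact: coord_continuous.
have tauC : Cinfty setT tau.
  by move=> k; apply: (CkD openT); [exact: Ck_linear|exact: Ck_cst].
have mcC k c : Cinfty setT (fun l : N => coordl 0 k l + c).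
  move=> m; apply: (CkD openT); last exact: Ck_cst.
  exact: (Ck_linear _ _ (@clc k)).
have tauq : tau q.2 = 0 by exact: subrr.
pose W' := setT `&` tau @^-1` B.
have oW' : open W'.
  apply: open_preimage_in oB _ => //; first exact: openT.
  by move=> x; exact: Cinfty_continuous.
have W'q : W' q.2 by split=> //; rewrite /= tauq.
have FC : Cinfty B (F psi).
  move=> k; apply: (Ck_comp (U' := setT) fV (@findim_R R) oB openT _ _ (@cenC 0 k)).
    by [].
  exact: Ck_sub (psiC k).
have FtC : Cinfty W' (F psi \o tau).
  move=> k; apply: (Ck_comp (U' := B) fN (@findim_R R) oW' oB _ _ (FC k)).
    by move=> l [].
  exact: Ck_sub (tauC k).
pose phi' (l : N) : N :=
  \row_j (if j == 0 then eps * (mc0 l - F psi (tau l)) else mcj j l).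
have phi'C : Cinfty W' phi'.
  move=> k; apply: (Ck_row oW') => j; have [->|j0] := eqVneq j 0.
    have C1 : Ck k W' (fun l => eps * (mc0 l - F psi (tau l))).
      apply: (CkM oW'); first exact: Ck_cst.
      apply: (CkD oW'); first exact: (Ck_sub (@subsetT _ W') (@mcC i0 _ k)).
      exact: (CkN oW' (FtC k)).
    by apply: (Ck_eq oW' _ C1) => l _; rewrite mxE.
  apply: (Ck_eq oW' _ (Ck_sub (@subsetT _ W') (@mcC (s j) (- q.2 0 (s j)) k))) => l _.
  by rewrite mxE (negbTE j0).
have eps0 : eps != 0 by rewrite sgr_eq0.
pose lam : N := q.2.
have inj' v : 'd phi' lam v = 0 -> v = 0.
  have dphi' : differentiable phi' lam by exact: Cinfty_differentiable phi'C W'q.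
  have dmc k c x : differentiable (fun l : N => coordl 0 k l + c) x /\
    'd (fun l : N => coordl 0 k l + c) x v = v 0 k.
    by have [d1 d2] := affine_diff c x (@clc k); rewrite d2.
  have dFt : differentiable (F psi \o tau) lam.
    exact: Cinfty_differentiable FtC W'q.
  have dF0 : differentiable (F psi) (tau lam).
    by rewrite tauq; exact: Cinfty_differentiable FC B0.
  have [dt dtE] := affine_diff (- dropl q.2) lam dlc.
  have FtE : 'd (F psi \o tau) lam v = 'd (F psi) (tau lam) (dropl v).
    apply: (eq_trans (congr1 (@^~ v) (diff_comp dt dF0))).
    by rewrite /= dtE.
  have phi'E j : ('d phi' lam v) 0 j =
      if j == 0 then eps * (v 0 i0 - 'd (F psi) (tau lam) (dropl v)) else v 0 (s j).
    rewrite (diff_coord _ _ dphi'); have [->|j0] := eqVneq j 0.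
      have [d1 d2] := dmc i0 (- q.2 0 i0) lam.
      have E1 := diff_sub_scale eps v d1 dFt.
      have E2 := congr2 (fun a b : R => eps * (a - b)) d2 FtE.
      rewrite -[RHS](eq_trans E1 E2).
      by congr ('d _ lam v); apply/funext => x; rewrite mxE.
    have [d1 <-] := dmc (s j) (- q.2 0 (s j)) lam.
    by congr ('d _ lam v); apply/funext => x; rewrite mxE (negbTE j0).
  (* The system is triangular: the entries with j <> 0 kill every parameter but the i0-th, hence
     also the differential of [F psi \o tau], and entry 0 then kills the i0-th. *)
  move=> Pv; have P0 j := phi'E j; rewrite Pv in P0.
  have vs j : j != 0 -> v 0 (s j) = 0.
    by move=> j0; have := P0 j; rewrite (negbTE j0) mxE.
  have dv : dropl v = 0.
    by apply/rowP => j; rewrite !mxE; case: eqP => // /eqP j0; rewrite vs.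
  have := P0 0; rewrite eqxx mxE dv linear0 subr0 => /esym/eqP.
  rewrite mulf_eq0 (negbTE eps0) => /eqP vi0.
  by rewrite (support_i0 vs) vi0 scale0r.
have [B' B'W c'] := full_chart oW' W'q phi'C inj'.
have [[_ oB' B'q _ _] _] := c'.
(* [W3] places [Psi x] where the division and the square root are valid, [B1] lets [psi] invert
   [Psi], and the last factor keeps projections inside the target chart. *)
pose U := (W3 `&` B1) `&` (sndl 'rV[R]_2 N) @^-1` B'.
have oU : open U.
  apply: openI; first exact: openI.
  by apply: open_comp oB' => x _; exact: sndl_continuous.
have Uq : U q by [].
have UW3 : U `<=` W3 by move=> x [[]].
have [B2 [psi2 [B2U c2 _ _ _]]] :=
  level_chart oU Uq Xq (Cinfty_sub (@subsetT _ U) XC) (Cinfty_sub UW3 phiC) injphi.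
exists B2, phi, B', phi'; split=> //.
- by apply/rowP => j; rewrite !mxE Dq mul0r; case: eqP => // _; exact: subrr.
- apply/rowP => j; rewrite !mxE tauq; case: eqP => _; last exact: subrr.
  have Fz : F psi 0 = 0 by rewrite /F psi0; exact: subrr.
  have mz : mc0 (projpi q) = 0 by exact: subrr.
  by rewrite Fz mz subr0 mulr0.
- move=> x Xx /B2U [[[_ B3x] B1x] B'x]; split=> //.
  have Yx : Y (Psi x) by exists x.
  have psix : psi (Psi x) = x by rewrite psiK //; apply/mem_set.
  have tx : tau (projpi x) = drop0 (Psi x).
    apply/rowP => j; rewrite !mxE; case: eqP => [_|j0]; first by rewrite subrr.
    by rewrite /cen.
  have mx : mc0 (projpi x) = F psi (Psi x) by rewrite /F psix /cen s0.
  apply/rowP => j; rewrite !mxE.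
  have [->|j0] := eqVneq j 0; last first.
    rewrite (_ : (j == 0%N :> nat) = false) //; apply/negbTE; move: j0.
    by apply: contraNneq => j0; apply/eqP/val_inj.
  (* Entry 0 of the target is [eps] times the difference of [F psi] at [Psi x] and at its drop, that
     is [D x ^+ 2 * H (Psi x)], the square of entry 0 of [phi x]. *)
  rewrite /= mx tx FG; last by have [] := B3x.
  have -> : Psi x 0 0 = D x by rewrite mxE.
  rewrite exprMn sqr_sqrtr; last by apply/ltW; have [] := B3x.
  by rewrite /H; ring.
Qed.

End Fold.

(** * Tangent spaces of E and immersivity of the projection *)

Section Assembly.
Context {R : realType} (r : nat).
Let V := ('rV[R]_2 * 'rV[R]_r)%type.
Variable X : V -> 'rV[R]_2.
Hypotheses (XC : Cinfty setT X) (Xr : regular_value X 0).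

Let tangentE q : X q = 0 -> tangent (Eset X) q = [set v | 'd X q v = 0].
Proof. by move=> Xq; apply: tangent_level => //; exact: Xr. Qed.

Lemma diff_homog (W W' : normedModType R) (f : W -> W') x (c : R) v :
  'd f x (c *: v) = c *: 'd f x v.
Proof. by rewrite linearZ. Qed.

Lemma surface_level (h : V -> R) (q : V) : Cinfty setT h -> X q = 0 -> h q = 0 ->
  (exists v, tangent (Eset X) q v /\ 'd h q v != 0) ->
  hypersurface_near r (Eset X) [set x | Eset X x /\ h x = 0] q /\
  tangent [set x | Eset X x /\ h x = 0] q = kerd (Eset X) h q.
Proof.
move=> hC Xq hq [v [tv hv]]; rewrite tangentE // in tv.
exact: (hypersurface_level XC hC Xq hq (Xr Xq) tv hv).
Qed.

Lemma ell_kerd (q : V) (q0 q1 p0 p1 : 'rV[R]_2) : X q = 0 ->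
  BT_frame (DxX X q) q0 q1 p0 p1 -> ell q0 = kerd (Eset X) (@projpi R r) q.
Proof.
move=> Xq fr; rewrite /kerd tangentE //; apply/seteqP; split=> v /=.
  move=> [c ->]; rewrite diff_projpi diff_homog -(mul_DxX XC) (frame_q0 fr).
  by rewrite !scaler0; split=> //=; rewrite scaler0.
case: v => u mu; rewrite diff_projpi /= => -[Xv mu0].
rewrite mu0 -(mul_DxX XC) in Xv; have [c ->] := frame_kernel fr Xv.
by exists c; rewrite mu0; congr pair; rewrite /= scaler0.
Qed.

Lemma ell_diff (W : normedModType R) (h : V -> W) (q : V) (q0 : 'rV[R]_2) :
  (ell q0 `<=` [set v | 'd h q v = 0]) <-> 'd h q ((q0, 0) : V) = 0.
Proof.
split=> [sub|h0 v [c ->]]; last by rewrite /= diff_homog h0 scaler0.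
by apply: sub; exists 1; rewrite scale1r.
Qed.

(** The line is the kernel of d pi on the tangent space of E, so its tangency to E is automatic and
    only the condition on [h] remains. *)
Lemma ell_kerd_diff (h : V -> R) (q : V) (q0 q1 p0 p1 : 'rV[R]_2) : X q = 0 ->
  BT_frame (DxX X q) q0 q1 p0 p1 ->
  (ell q0 `<=` kerd (Eset X) h q) <-> 'd h q ((q0, 0) : V) = 0.
Proof.
move=> Xq fr; rewrite -ell_diff; split=> sub v lv; first by have [] := sub v lv.
split; last exact: sub.
by have : ell q0 v := lv; rewrite (ell_kerd Xq fr) => -[].
Qed.

(** Two tangent vectors with the same projection differ by some [(u, 0)]. Tangency of this
    difference to E means [u *m DxX X q = 0], and tangency to the hypersurface adds that the
    differential of [h] vanishes on it. *)
Lemma not_immersion (h : V -> R) (q : V) : X q = 0 ->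
  tangent [set x | Eset X x /\ h x = 0] q = kerd (Eset X) h q ->
  ~ immersion_at [set x | Eset X x /\ h x = 0] (@projpi R r) q <->
  exists u : 'rV[R]_2, [/\ u != 0, u *m DxX X q = 0 & 'd h q ((u, 0) : V) = 0].
Proof.
move=> Xq tE; rewrite /immersion_at tE /kerd tangentE //.
split=> [nimm|[u [u0 uJ hu]] imm].
  apply: contrapT => noU; apply: nimm => v v' /set_mem [Xv hv] /set_mem [Xv' hv'].
  rewrite !diff_projpi => vv'.
  have vE : v - v' = ((v.1 - v'.1, 0) : V).
    by case: v {Xv hv} vv' => a b; case: v' {Xv' hv'} => a' b' /= ->; congr pair; rewrite /= subrr.
  apply/eqP; rewrite -subr_eq0 vE; apply/negP => /negP d0.
  apply: noU; exists (v.1 - v'.1); split.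
  - by apply: contraNneq d0 => ->.
  - by rewrite (mul_DxX XC) -vE linearB Xv Xv' subrr.
  - by rewrite -vE linearB hv hv' subrr.
have : ((u, 0) : V) = 0.
  apply: imm; rewrite ?inE /= ?linear0 //.
    by rewrite -(mul_DxX XC).
  by rewrite !diff_projpi.
by move=> [/eqP]; rewrite (negbTE u0).
Qed.

End Assembly.

(** * The fold at a Bogdanov--Takens point *)

Section Fold.
Context {R : realType}.

(** Where the trace vanishes, the adjugate is minus the matrix; this is what identifies [w q] with
    [- p1]. *)
Lemma adj2 (A : 'M[R]_2) : \adj A = (\tr A)%:M - A.
Proof.
have lift0 : lift 0 0 = 1 :> 'I_2 by apply/val_inj.
have lift1 : lift 1 0 = 0 :> 'I_2 by apply/val_inj.
apply/matrixP => i j; rewrite mxE /cofactor det_mx11 !mxE tr2.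
have [->|->] : i = 0 \/ i = 1 by case: i => -[|[|//]] ?; [left|right]; apply/val_inj.
  have [->|->] : j = 0 \/ j = 1 by case: j => -[|[|//]] ?; [left|right]; apply/val_inj.
    by rewrite ?lift0 ?lift1 /= expr0; ring.
  by rewrite ?lift0 ?lift1 /= expr1; ring.
have [->|->] : j = 0 \/ j = 1 by case: j => -[|[|//]] ?; [left|right]; apply/val_inj.
  by rewrite ?lift0 ?lift1 /= expr1; ring.
by rewrite ?lift0 ?lift1 /=; ring.
Qed.

(** [p1] annihilates the image of D_xX(q). If it annihilated all parameter derivatives as well, it
    would vanish on the range of ['d X q], which contains [q1] by regularity, against
    [dotp q1 p1 = 1]. *)
Lemma BT_parameter_direction (r : nat) (X : 'rV[R]_2 * 'rV[R]_r -> 'rV[R]_2) q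
    (q0 q1 p0 p1 : 'rV[R]_2) :
  Cinfty setT X -> regular_value X 0 -> X q = 0 ->
  BT_frame (DxX X q) q0 q1 p0 p1 ->
  exists i, dotp ('d X q (0, delta_mx 0 i)) p1 != 0.
Proof.
move=> XC Xr Xq [[_ _ p1J _] [_ e11 _ _]].
pose V := ('rV[R]_2 * 'rV[R]_r)%type.
apply: contrapT => /forallNP no.
have dX0 (v : V) : dotp ('d X q v) p1 = 0.
  have -> : v = ((v.1, 0) : V) + \sum_i v.2 0 i *: ((0, delta_mx 0 i) : V).
    rewrite (_ : \sum_i _ = inrl 'rV[R]_2 'rV[R]_r v.2).
      by case: v => a b; congr pair; rewrite /= ?addr0 ?add0r.
    rewrite [in RHS](row_sum_delta v.2) linear_sum.
    by apply: eq_bigr => i _; rewrite linearZ.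
  rewrite linearD dotpDl -(mul_DxX XC) -dotp_mul_tr p1J linear_sum.
  rewrite (_ : dotp (\sum_i _) _ =
      \sum_i v.2 0 i * dotp ('d X q ((0, delta_mx 0 i) : V)) p1).
    rewrite big1 ?addr0 => [|i _]; first by rewrite dotp2 !mxE !mulr0 addr0.
    by have /negP := no i; rewrite negbK => /eqP ->; rewrite mulr0.
  elim/big_rec2: _ => [|i y1 y2 _ <-]; first by rewrite dotp2 !mxE !mul0r addr0.
  by rewrite linearZ dotpDl dotpZl.
have : range ('d X q) q1 by rewrite Xr.
move=> [v _ vq1]; have := dX0 v; rewrite vq1 e11 => /eqP.
by rewrite oner_eq0.
Qed.

Lemma BT_whitney_fold (r : nat) (X : 'rV[R]_2 * 'rV[R]_r -> 'rV[R]_2) q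
    (q0 q1 p0 p1 : 'rV[R]_2) :
  Cinfty setT X -> regular_value X 0 -> BT_point X q ->
  BT_frame (DxX X q) q0 q1 p0 p1 -> BT_a X q q0 p1 != 0 ->
  whitney_fold r (Eset X) [set: 'rV[R]_r] (@projpi R r) q.
Proof.
case: r X q => [|r] X q XC Xr [Xq tq dq _] fr a0.
  (* For r = 0 the transverse parameter would be an element of the empty type ['I_0]. *)
  by have [[]] := BT_parameter_direction XC Xr Xq fr.
have [i0 wi0] := BT_parameter_direction XC Xr Xq fr.
have [[_ _ _ p0J] [e00 _ _ _]] := fr.
pose V := ('rV[R]_2 * 'rV[R]_r.+1)%type.
pose w (x : V) : 'rV[R]_2 := p0 *m (\adj (DxX X x))^T.
have wX (x : V) (u : 'rV[R]_2) :
    dotp ('d X x ((u, 0) : V)) (w x) = detX X x * dotp u p0.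
  rewrite /w dotp_mul_tr -(mul_DxX XC) -mulmxA mul_mx_adj mul_mx_scalar.
  by rewrite dotpZl.
have wq : w q = - p1.
  by rewrite /w adj2 -/(trX X q) tq raddf0 sub0r linearN mulmxN p0J.
have [dD _] := BT_diff XC fr.
apply: (@fold_normal_form R r X w (detX X) q q0 p0 i0) => //.
- exact: detX_Cinfty.
- move=> k; apply: (Ck_row openT) => j.
  have sC : Ck k setT (fun x => \sum_i p0 0 i * \adj (DxX X x) j i).
    apply: (Ck_sum openT) => i; apply: (CkM openT); first exact: Ck_cst.
    have cC : Ck k setT (fun x => cofactor (DxX X x) i j).
      apply: (CkM openT); first exact: Ck_cst.
      apply: (Ck_det openT) => a b.
      have := DxX_Cinfty XC (lift i a) (lift j b) k.
      by apply: (Ck_eq openT) => x _; rewrite !mxE.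
    by apply: (Ck_eq openT _ cC) => x _; rewrite mxE.
  by apply: (Ck_eq openT _ sC) => x _; rewrite mxE; apply: eq_bigr => i _; rewrite !mxE.
- by move=> u; rewrite -(mul_DxX XC); exact: (frame_kernel fr).
- by rewrite dD oppr_eq0 mulf_neq0 // pnatr_eq0.
- by rewrite wq -[- p1]scaleN1r dotpC dotpZl mulN1r oppr_eq0 dotpC.
- by rewrite e00 oner_neq0.
Qed.

End Fold.

Theorem theoremB (R : realType) (r : nat)
    (X : 'rV[R]_2 * 'rV[R]_r -> 'rV[R]_2)
    (X_smooth : Cinfty setT X) (X_regular : regular_value X 0) :
  is_manifold r (Eset X) /\
  (forall (q : 'rV[R]_2 * 'rV[R]_r) (q0 q1 p0 p1 : 'rV[R]_2),
    BT_point X q ->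
    BT_frame (DxX X q) q0 q1 p0 p1 ->
    let E := Eset X in
    let a := BT_a X q q0 p1 in
    let b := BT_b X q q0 q1 p0 p1 in
    let l : set ('rV[R]_2 * 'rV[R]_r) := ell q0 in
    l = kerd E (@projpi R r) q /\
    (* (i) *)
    ('d (detX X) q (q0, 0) = - (2 * a) /\ 'd (trX X) q (q0, 0) = b) /\
    (* (ii) *)
    ((a != 0 <-> ~ (l `<=` kerd E (detX X) q)) /\
     (a != 0 ->
       [/\ exists v, tangent E q v /\ 'd (detX X) q v != 0,
           hypersurface_near r E (Sigma X) q,
           tangent (Sigma X) q = kerd E (detX X) q &
           whitney_fold r E [set: 'rV[R]_r] (@projpi R r) q])) /\
    (* (iii) *)
    ((exists v, tangent E q v /\ 'd (trX X) q v != 0) ->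
       [/\ hypersurface_near r E (Hhat X) q,
           tangent (Hhat X) q = kerd E (trX X) q,
           b = 0 <-> l `<=` tangent (Hhat X) q &
           l `<=` tangent (Hhat X) q <->
             ~ immersion_at (Hhat X) (@projpi R r) q])) /\
  (* (iv) *)
  (forall q : 'rV[R]_2 * 'rV[R]_r,
    Hhat X q ->
    (exists v, tangent (Eset X) q v /\ 'd (trX X) q v != 0) ->
    DxX X q != 0 ->
    ~ immersion_at (Hhat X) (@projpi R r) q ->
    [/\ BT_point X q,
        exists q0 q1 p0 p1, BT_frame (DxX X q) q0 q1 p0 p1 &
        forall q0 q1 p0 p1, BT_frame (DxX X q) q0 q1 p0 p1 ->
          BT_b X q q0 q1 p0 p1 = 0]).
Proof.
have XC := X_smooth; have Xr := X_regular.
split; first exact: manifold_level.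
split.
  move=> q q0 q1 p0 p1 BT fr E a b l; have [Xq tq dq _] := BT.
  have [dD dT] := BT_diff XC fr.
  have lE : l = kerd E (@projpi R r) q by exact: (ell_kerd XC Xr Xq fr).
  have lD := ell_kerd_diff XC Xr (detX X) Xq fr.
  have lT := ell_kerd_diff XC Xr (trX X) Xq fr.
  have lq : l (q0, 0) by exists 1; rewrite scale1r.
  have tq0 : tangent E q (q0, 0) by have := lq; rewrite lE => -[].
  split=> //; split=> //; split.
    have aD : a != 0 <-> 'd (detX X) q (q0, 0) != 0.
      have two0 : 2 != 0 :> R by rewrite pnatr_eq0.
      by rewrite dD oppr_eq0 [2 * _ == 0]mulf_eq0 (negbTE two0).
    split.
      rewrite aD; split=> [D0 /lD D0'|nD]; first by rewrite D0' eqxx in D0.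
      by apply/eqP => D0; apply: nD; apply/lD.
    move=> a0; have exv : exists v, tangent E q v /\ 'd (detX X) q v != 0.
      by exists (q0, 0); split=> //; apply/aD.
    have [hs tS] := surface_level XC Xr (detX_Cinfty XC) Xq dq exv.
    by split=> //; exact: (BT_whitney_fold XC Xr BT fr a0).
  move=> exv; have [hs tH] := surface_level XC Xr (trX_Cinfty XC) Xq tq exv.
  split=> //.
    by rewrite tH lT dT.
  rewrite tH lT (not_immersion XC Xr Xq tH); split=> [T0|[u [u0 uJ hu]]].
    exists q0; split=> //; first exact: (frame_q0_neq0 fr).
    exact: (frame_q0 fr).
  (* The null vector given by the failure of immersion is a nonzero multiple of [q0], so the
     vanishing of dT passes to [q0]. *)
  have [c uE] := frame_kernel fr uJ; apply/(ell_diff (trX X) q q0) => v [c' ->] /=.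
  have c0 : c != 0 by apply: contraNneq u0 => c0; rewrite uE c0 scale0r.
  have T0 : 'd (trX X) q ((q0, 0) : 'rV[R]_2 * 'rV[R]_r) = 0.
    apply: (scalerI c0); rewrite scaler0 -diff_homog.
    by move: hu; rewrite uE; congr ('d _ q _ = 0); congr pair; rewrite /= scaler0.
  by rewrite diff_homog T0 scaler0.
move=> q [Xq tq] exv J0 nimm.
have [hs tH] := surface_level XC Xr (trX_Cinfty XC) Xq tq exv.
(* Non-immersion supplies a null vector of D_xX(q), hence determinant 0; together with trace 0 and a
   nonzero matrix this is the nilpotent rank one case, framed on [u] itself. *)
have [u [u0 uJ Tu]] := (not_immersion XC Xr Xq tH).1 nimm.
have dJ : \det (DxX X q) = 0.
  by apply/eqP/det0P; exists u.
have [rJ [q1 [p0 [p1 fr]]]] := rank1_nilpotent_frame tq dJ J0 u0 uJ.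
split; first by split.
  by exists u, q1, p0, p1.
move=> q0 q1' p0' p1' fr'.
(* In any frame b is the derivative of the trace along its own kernel vector, which is a multiple of
   [u]. *)
have [_ <-] := BT_diff XC fr'.
have [c q0E] := frame_kernel fr (frame_q0 fr').
have -> : ((q0, 0) : 'rV[R]_2 * 'rV[R]_r) = c *: ((u, 0) : 'rV[R]_2 * 'rV[R]_r).
  by rewrite q0E; congr pair; rewrite /= scaler0.
by rewrite diff_homog Tu scaler0.
Qed.
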